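(* Let $q,r$ be distinct primes and suppose either (i) $r\in\{3,5\}$, $q$ is odd, and $R\cong \mathrm{C}_q\times\mathrm{D}_{2r}$; or (ii) $R$ is a nonabelian group isomorphic to $\mathrm{C}_q\rtimes\mathrm{C}_r$. Let $S\subseteq R$, assume $S=S^{-1}$ in case (i), and let $G$ be a group with $\hat R<G\leq \mathrm{Aut}(\mathrm{Cay}(R,S))$ such that $\hat R$ is a maximal subgroup of $G$. Then one of the following occurs: (1) $\mathrm{Aut}(R)_S>1$; (2) $\hat R$ is core-free in $G$ and $G$ is almost simple; or (3) $R\cong\mathrm{C}_q\times\mathrm{D}_{2r}$, the core of $\hat R$ in $G$ is the (right regular image of the) subgroup $\mathrm{C}_q$ of $R$, and $G/\mathrm{C}_q$ is almost simple.
   Context: $\mathrm{C}_n$ is the cyclic group of order $n$, $\mathrm{D}_{2n}$ the dihedral group of order $2n$. For a group $R$ and $S\subseteq R$, the Cayley digraph $\mathrm{Cay}(R,S)$ has vertex set $R$ and an arc from $r$ to $sr$ whenever $s\in S$; $\hat R$ denotes the right regular representation of $R$, a subgroup of $\mathrm{Aut}(\mathrm{Cay}(R,S))$. $\mathrm{Aut}(R)_S$ is the group of automorphisms of $R$ fixing $S$ setwise. The core of a subgroup $X$ in $G$ is the largest normal subgroup of $G$ contained in $X$; $X$ is core-free if its core is trivial. *)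

(* Defs.v *)
From HB Require Import structures.
From mathcomp Require Import all_boot all_fingroup all_solvable.
Set Implicit Arguments.
Unset Strict Implicit.
Unset Printing Implicit Defensive.
Local Open Scope group_scope.

Definition rreg (gT : finGroupType) : {set {perm gT}} :=
  actperm 'R @* [set: gT].

Definition rreg_of (gT : finGroupType) (K : {set gT}) : {set {perm gT}} :=
  actperm 'R @* K.

(* Automorphism group of the Cayley digraph Cay(gT,S): arcs x -> s x (s in S),
   i.e. x -> y iff y * x^-1 \in S. *)
Definition AutCay (gT : finGroupType) (S : {set gT}) : {set {perm gT}} :=
  [set p : {perm gT} | [forall x, forall y,
     (y * x^-1 \in S) == (p y * (p x)^-1 \in S)]].

Definition AutS (gT : finGroupType) (S : {set gT}) : {set {perm gT}} :=
  [set a in Aut [set: gT] | a @: S == S].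

(* G is almost simple: T <= G <= Aut(T) for a nonabelian simple T,
   i.e. G has a nonabelian simple normal subgroup with trivial centraliser. *)
Definition almost_simple (gT : finGroupType) (G : {set gT}) : Prop :=
  exists T : {group gT}, [/\ T <| G, simple T, ~~ abelian T & 'C_G(T) = 1].

Definition is_Cq_x_D2r (gT : finGroupType) (K D : {group gT}) (q r : nat) : Prop :=
  [/\ K \x D = [set: gT], cyclic K, #|K| = q & D \isog 'D_(2 * r)].

(* Main.v *)
Require Import Defs.
From mathcomp Require Import all_boot all_fingroup all_solvable.
From mathcomp Require Import vcharacter.
Local Open Scope group_scope.
Set Implicit Arguments.
Unset Strict Implicit.
Unset Printing Implicit Defensive.

(* Write G = R L with L the stabiliser of 1, let N be the core of R and M / N a
   minimal normal subgroup of G / N; S is the trace on R of a union of L-double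
   cosets.  If M / N is not abelian, solvability of the maximal subgroup R / N
   forces M :&: R > N (coprime action), and then the squarefree order of R
   leaves room for a single simple factor; if moreover R / N is abelian, G / N
   is a Frobenius group and its kernel gives a contradiction.  If M / N is a
   p-group, then #|L| = #|M / N| and L is a p-group, so it is either a twisted
   complement of R, next to a normal complement E, or a complement of a Sylow
   subgroup N0 of N in a normal abelian p-subgroup E.  In the first case, for
   x in E L :&: R and y in R, either y does not normalise E :&: L, which makes
   L y L so large that it contains y ^ x, or y ^ x lies in L y L for a direct
   reason, so conjugation by x preserves S.  In the second case S is a union of
   cosets of N0 outside 'N(L), and a suitable conjugation, possibly composed
   with inversion on C_q, preserves S.  For D_2r this uses that a subset of Z/r
   is symmetric about some point when r = 3 or 5. *)

(** * Maximal subgroups and coprime action *)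

Section Basics.
Variable aT : finGroupType.
Implicit Types G R M A L H E P Q : {group aT}.

Lemma maximal_over G R H : maximal R G -> R \subset H -> H \subset G -> H :=: R \/ H :=: G.
Proof.
move=> maxR; have /maximal_eqP[_ max] : maximal_eq R G by rewrite /maximal_eq maxR orbT.
exact: max.
Qed.

Lemma maximal_mulg_norm G R A :
  maximal R G -> A \subset G -> R \subset 'N(A) -> A \subset R \/ A * R = G.
Proof.
move=> maxR sAG nAR; have sRG := proper_sub (maxgroupp maxR).
case: (maximal_over maxR (joing_subr A R)); rewrite ?joing_subr ?join_subG ?sAG //= norm_joinEr //.
  by move=> <-; left; rewrite mulG_subl.
by right.
Qed.

(** In a Sylow [p]-subgroup [P] of [M A] containing [A], the nontrivial normal subgroup [M :&: P]
    meets the centre of [P], which centralises [A]. *)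
Lemma pgroup_subcent_neq1 (p : nat) A M :
  p.-group A -> A \subset 'N(M) -> prime p -> p %| #|M| -> 'C_M(A) != 1.
Proof.
move=> pA nMA p_pr pM; have sAMA: A \subset M <*> A by rewrite joing_subr.
have [P sylP sAP] := Sylow_superset sAMA pA.
have nsM: M <| M <*> A by rewrite /normal joing_subl join_subG normG.
have sylPM := Sylow_setI_normal nsM sylP.
have pP := pHall_pgroup sylP.
have nsPM: M :&: P <| P.
  rewrite /normal subsetIr normsI ?normG //.
  by apply: subset_trans (pHall_sub sylP) (normal_norm nsM).
have ntPM: (M :&: P)%G :!=: 1.
  by rewrite -rank_gt0 (rank_Sylow sylPM) p_rank_gt0 mem_primes p_pr cardG_gt0.
apply: contraNneq (meet_center_nil (pgroup_nil pP) nsPM ntPM) => C1.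
by rewrite -subG1 -C1 /= -setIA setIS // setIA subIset // orbC centS.
Qed.

(* A minimal normal p-subgroup A of R either has nontrivial fixed points on M or
   acts coprimely and fixed point freely; then the A-invariant Sylow subgroups of
   M are unique, hence R-invariant. *)
Lemma solvable_irr_abelian R M :
  solvable R -> R \subset 'N(M) -> R :!=: 1 -> 'C_R(M) = 1 ->
  (forall H, H \subset M -> R \subset 'N(H) -> H :=: 1 \/ H :=: M) ->
  abelian M.
Proof.
move=> solR nMR ntR CRM irr.
have [-> | ntM] := eqVneq (M : {set aT}) 1; first exact: abelian1.
have [A minA sAR] := minnormal_exists ntR (normG R).
have [nAR ntA /is_abelemP[p p_pr abelA]] := minnormal_solvable minA sAR solR.
have pA := abelem_pgroup abelA.
have nMA := subset_trans sAR nMR.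
have nCR: R \subset 'N('C_M(A)) by rewrite normsI ?norms_cent.
have C1: 'C_M(A) = 1.
  have [//|CM] := irr _ (subsetIl M 'C(A)) nCR.
  case/negP: ntA; rewrite -subG1 -CRM subsetI sAR centsC.
  by rewrite -{1}CM subsetIr.
have p'M: ~~ (p %| #|M|).
  by apply/negP=> /(pgroup_subcent_neq1 pA nMA p_pr); rewrite C1 eqxx.
have coMA: coprime #|M| #|A|.
  by rewrite coprime_sym; apply: pnat_coprime pA _; rewrite p'natE.
have solA := solvableS sAR solR.
pose l := pdiv #|M|; have l_pr: prime l by rewrite pdiv_prime ?cardG_gt1.
have [P sylP nPA] := sol_coprime_Sylow_exists l solA nMA coMA.
have tr := sol_coprime_Sylow_trans l solA nMA coMA.
have Puniq Q: l.-Sylow(M) Q -> A \subset 'N(Q) -> Q :=: P.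
  move=> sylQ nQA.
  have Pin : P \in [set P0 in 'Syl_l(M) | A \subset 'N(P0)] by rewrite !inE sylP.
  have Qin : Q \in [set P0 in 'Syl_l(M) | A \subset 'N(P0)] by rewrite !inE sylQ.
  have [x] := atransP2 tr Pin Qin.
  by rewrite /= C1 => /set1gP-> ->; rewrite /= conjsg1.
have nPR: R \subset 'N(P).
  apply/normsP=> x Rx; apply: (Puniq (P :^ x)%G).
    by rewrite -(normsP nMR x Rx) pHallJ2.
  by rewrite -(normsP nAR x Rx) normJ conjSg.
have ntP: P :!=: 1.
  rewrite -rank_gt0 (rank_Sylow sylP) p_rank_gt0 mem_primes l_pr cardG_gt0 /=.
  exact: pdiv_dvd.
have [P1|PM] := irr _ (pHall_sub sylP) nPR; first by rewrite P1 eqxx in ntP.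
have lM: l.-group M by rewrite -PM (pHall_pgroup sylP).
have [Z1|ZM] := irr _ (center_sub M) (gFnorm_trans _ nMR).
  by case/negP: ntM; apply/eqP; apply: trivg_center_pgroup lM Z1.
by apply/center_idP.
Qed.

End Basics.

(** * Primitive groups with a solvable point stabiliser *)

Section Socle.
Variable aT : finGroupType.
Implicit Types G R M A L H E P Q T : {group aT}.

Lemma corefree_eq1 G R A :
  gcore R G = 1 -> A \subset R -> G \subset 'N(A) -> A :=: 1.
Proof.
by move=> core1 sAR nAG; apply/eqP; rewrite -subG1 -core1 gcore_max.
Qed.

Lemma minnormal_corefree_mulG G R M :
  maximal R G -> gcore R G = 1 -> minnormal M G -> M \subset G -> M * R = G.
Proof.
move=> maxR core1 /mingroupP[/andP[ntM nMG] _] sMG.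
have sRG : R \subset G by case/maxgroupP: maxR => /proper_sub.
case: (maximal_mulg_norm maxR sMG (subset_trans sRG nMG)) => // sMR.
by rewrite (corefree_eq1 core1 sMR nMG) eqxx in ntM.
Qed.

(** ['C_R(M)] is normalised by [M] and [R], hence trivial. If [M :&: R] were trivial, maximality
    would make [R] irreducible on [M], so [M] abelian by [solvable_irr_abelian]. If ['C_G(M)] were
    nontrivial, it would not lie in [R], so [G = 'C_G(M) R] would normalise [M :&: R], making it
    trivial. *)
Lemma nonabelian_minnormal_meet G R M :
  solvable R -> R :!=: 1 -> maximal R G -> gcore R G = 1 ->
  minnormal M G -> M \subset G -> ~~ abelian M -> 'C_G(M) = 1 /\ M :&: R != 1.
Proof.
move=> solR ntR maxR core1 minM sMG nabM.
have defG := minnormal_corefree_mulG maxR core1 minM sMG.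
have sRG : R \subset G by case/maxgroupP: maxR => /proper_sub.
have /mingroupP[/andP[ntM nMG] minM'] := minM.
have nMR := subset_trans sRG nMG.
have CRM1 : 'C_R(M) = 1.
  apply: (corefree_eq1 core1 (subsetIl _ _)) => /=.
  rewrite -defG mul_subG //.
    by rewrite cents_norm // centsC subsetIr.
  by rewrite normsI ?normG ?norms_cent.
have meet : M :&: R != 1.
  apply/negP=> /eqP MR1; case/negP: nabM.
  apply: (solvable_irr_abelian solR nMR ntR CRM1) => H sHM nHR.
  have [sHR|HR] := maximal_mulg_norm maxR (subset_trans sHM sMG) nHR.
    by left; apply/trivgP; rewrite -MR1 subsetI sHM.
  right; have := group_modl R sHM; rewrite HR setIC MR1 mulg1.
  by rewrite (setIidPr sMG) => ->.
split=> //; apply/eqP; apply: contraNT meet => ntC.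
have nCG : G \subset 'N('C_G(M)) by rewrite normsI ?normG ?norms_cent.
have [sCR|CR] := maximal_mulg_norm maxR (subsetIl G 'C(M)) (subset_trans sRG nCG).
  by case/negP: ntC; rewrite -subG1 -CRM1 subsetI sCR subsetIr.
apply/eqP; apply: (corefree_eq1 core1 (subsetIr _ _)) => /=.
rewrite -CR mul_subG //; last by rewrite normsI ?normG.
by rewrite cents_norm // (subset_trans (subsetIr _ _)) // centS ?subsetIl.
Qed.

(** For [T] minimal normal in [M], the distinct [G]-conjugates of [T] commute and generate [M]. The
    aim is that [R] normalises [T]; then [G = M R] does, and [T = M]. *)
Lemma nonabelian_minnormal_almost_simple G R M :
  solvable R -> R :!=: 1 -> maximal R G -> gcore R G = 1 ->
  (forall p, logn p #|R| <= 1) ->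
  minnormal M G -> M \subset G -> ~~ abelian M -> almost_simple G.
Proof.
move=> solR ntR maxR core1 sqf minM sMG nabM.
have [CM1 ntB] := nonabelian_minnormal_meet solR ntR maxR core1 minM sMG nabM.
have defG := minnormal_corefree_mulG maxR core1 minM sMG.
have sRG : R \subset G by case/maxgroupP: maxR => /proper_sub.
have /mingroupP[/andP[ntM nMG] minM'] := minM.
have nMR := subset_trans sRG nMG.
exists M; split=> //; first by rewrite /normal sMG.
have [T minT sTM] := minnormal_exists ntM (normG M).
have /mingroupP[/andP[ntT nTM] minT'] := minT.
have TJ x : x \in G -> T :^ x \subset M by move=> Gx; rewrite -(normsP nMG x Gx) conjSg.
have nTJM x : x \in G -> M \subset 'N(T :^ x).
  by move=> Gx; rewrite -(normsP nMG x Gx) normJ conjSg.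
have TI x : x \in G -> T :^ x != T -> T :^ x :&: T = 1.
  move=> Gx neT; apply/eqP; apply: contraNT neT => ntI.
  have eqT : T :^ x :&: T = T.
    by apply: minT'; rewrite ?subsetIr //= ntI normsI ?nTJM.
  rewrite eq_sym eqEcard cardJg leqnn andbT -{1}eqT subsetIl //.
have TC x : x \in G -> T :^ x != T -> T :^ x \subset 'C(T).
  move=> Gx neT; rewrite (sameP commG1P trivgP) -(TI x Gx neT) subsetI.
  by rewrite commg_subl commg_subr (subset_trans sTM (nTJM x Gx)) (subset_trans (TJ x Gx) nTM).
have genM : << class_support T G >> = M :> {set aT}.
  have sGen : << class_support T G >> \subset M.
    rewrite gen_subG class_supportEr; apply/bigcupsP=> x; exact: TJ.
  apply: minM' => //=; rewrite norms_gen ?class_support_norm // andbT.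
  apply: contraNneq ntT => Gen1; rewrite -subG1 -Gen1.
  by rewrite sub_gen // sub_class_support.
have sMX (X : {group aT}) : (forall x, x \in G -> T :^ x \subset X) -> M \subset X.
  move=> sX; rewrite -genM gen_subG class_supportEr; apply/bigcupsP=> x; exact: sX.
have sMT : M \subset T <*> 'C_M(T).
  apply: sMX => x Gx; have [-> | neT] := eqVneq (T :^ x) T; first exact: joing_subl.
  by rewrite (subset_trans _ (joing_subr _ _)) // subsetI TJ // TC.
have solB: solvable (M :&: R) by rewrite (solvableS _ solR) ?subsetIr.
have nabT: ~~ abelian T.
  apply: contra nabM => abT.
  have cMT : M \subset 'C(T).
    apply: sMX => x Gx; have [->|neT] := eqVneq (T :^ x) T; first exact: abT.
    exact: TC.
  have sTC : T \subset 'C_G(M) by rewrite subsetI (subset_trans sTM) // centsC.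
  by case/negP: ntT; rewrite -subG1 -CM1.
have nsolT : ~~ solvable T.
  apply: contra nabT => solT.
  by have [_ _ /is_abelemP[p _ /abelem_abelian]] := minnormal_solvable minT (subxx _) solT.
have nCM : M \subset 'N('C_M(T)) by rewrite normsI ?normG ?norms_cent.
(* [V] is proper in [M]: otherwise [M / 'C_M(T)] would be a quotient of the solvable [M :&: R], and
   [T] would be solvable. *)
pose V := ((M :&: R) <*> 'C_M(T))%G.
have defV : V = (M :&: R) * 'C_M(T) :> {set aT}.
  by rewrite /V /= norm_joinEl // subIset // nCM.
have neVM : V != M :> {set aT}.
  apply: contra nsolT => /eqP VM.
  have solMC : solvable (M / 'C_M(T)).
    have : solvable (V / 'C_M(T)) by rewrite defV quotientMidr quotient_sol.
    by rewrite VM.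
  have : solvable (T / 'C_M(T)) by apply: solvableS solMC; rewrite quotientS.
  have nCT := subset_trans sTM nCM.
  rewrite -(isog_sol (second_isog nCT)) => solTC.
  have nsCT : 'C_M(T) :&: T <| T.
    by rewrite /normal subsetIr normsI ?normG.
  rewrite (series_sol nsCT) solTC andbT; apply: abelian_sol.
  apply: subset_trans (subset_trans (subsetIl _ _) (subsetIr _ _)) _.
  by rewrite centS // subsetIr.
(* by maximality M :&: R is the R-core of V *)
have sVM : V \subset M by rewrite join_subG !subsetIl.
have sUR : gcore V R \subset R.
  have sUM := subset_trans (gcore_sub V R) sVM.
  have [//|UR] := maximal_mulg_norm maxR (subset_trans sUM sMG) (gcore_norm V R).
  case/negP: neVM; rewrite eqEsubset sVM /=.
  have defM := group_modl R sUM; rewrite UR (setIidPr sMG) in defM.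
  rewrite -{1}defM.
  apply: mul_subG; first exact: gcore_sub.
  by rewrite setIC joing_subl.
have VJ x : x \in R -> V :^ x = (M :&: R) <*> 'C_M(T :^ x).
  move=> Rx; rewrite /V /= conjYg !conjIg -centJ (normsP nMR x Rx).
  by rewrite (conjGid Rx).
(* If this meet is trivial, write [b] in [M :&: R] as [t c] with [t] in [T] and [c] in ['C_M(T)].
   Every [R]-conjugate of [V] contains [t], so [t] lies in [gcore V R], hence in [R], and [t = 1].
   Thus [M :&: R] centralises every conjugate of [T], hence [M], and is trivial. *)
have ntBT : M :&: R :&: T != 1.
  apply: contra ntB => /eqP BT1; rewrite -subG1 -CM1 subsetI subIset ?sMG //=.
  rewrite centsC; apply: sMX => y Gy; rewrite centsC.
  have [m Mm [x Rx ->]] : exists2 m, m \in M & exists2 x, x \in R & y = m * x.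
    by move: Gy; rewrite -{1}defG => /mulsgP[m x Mm Rx ->]; exists m => //; exists x.
  rewrite conjsgM (normsP nTM m Mm) -(conjGid Rx) -{1}(normsP nMR x Rx) -conjIg.
  rewrite centJ conjSg.
  apply/subsetP=> b Bb; have [Mb Rb] := setIP Bb.
  have : b \in T * 'C_M(T).
    by rewrite -norm_joinEr ?(subsetP sMT) // subIset ?nTM.
  case/mulsgP=> t c Tt /setIP[Mc Cc] def_b.
  suff: t \in M :&: R :&: T.
    by rewrite BT1 => /set1gP t1; rewrite def_b t1 mul1g.
  rewrite in_setI Tt andbT in_setI (subsetP sTM) //=.
  apply: (subsetP sUR); apply/bigcapP=> z Rz; rewrite VJ //.
  have Gz := subsetP sRG z Rz.
  have [-> | neT] := eqVneq (T :^ z) T.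
    have -> : t = b * c^-1 by rewrite def_b mulgK.
    by rewrite groupM ?mem_gen // inE ?Bb // orbC groupV inE Mc Cc.
  rewrite mem_gen // inE orbC inE (subsetP sTM) //=.
  by have := TC z Gz neT; rewrite centsC => /subsetP->.
(* so two distinct conjugates of T would give p^2 | #|R| *)
have nTR : R \subset 'N(T).
  apply/normsP=> x Rx; apply/eqP; apply: contraT => neT.
  have Gx := subsetP sRG x Rx.
  pose B1 := (M :&: R :&: T)%G.
  have tiB : B1 :&: B1 :^ x = 1.
    by apply/trivgP; rewrite -(TI x Gx neT) setIC setISS ?conjSg ?subsetIr.
  have cB : B1 :^ x \subset 'C(B1).
    apply: subset_trans (centS (subsetIr _ _)); apply: subset_trans (TC x Gx neT).
    by rewrite conjSg subsetIr.
  have sBR : B1 * B1 :^ x \subset R.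
    have sB1R : B1 \subset R by apply: subset_trans (subsetIl _ _) (subsetIr _ _).
    by apply: mul_subG; rewrite // -(conjGid Rx) conjSg.
  have := sqf (pdiv #|B1|).
  have pr : prime (pdiv #|B1|) by rewrite pdiv_prime // cardG_gt1.
  have := dvdn_leq_log (pdiv #|B1|) (cardG_gt0 R) (cardSg (_ : (B1 <*> B1 :^ x)%G \subset R)).
  rewrite /= cent_joinEr // => /(_ sBR).
  rewrite TI_cardMg // cardJg lognM // => h1 h2.
  have : 0 < logn (pdiv #|B1|) #|B1|.
    by rewrite logn_gt0 mem_primes pr cardG_gt0 pdiv_dvd.
  by move=> h3; have := leq_trans h1 h2; rewrite leqNgt; case: (logn _ _) h3 => // k; rewrite addSn addnS.
have TM : T = M :> {set aT}.
  apply: minM'; rewrite ?sTM //= ntT /= -defG mul_subG //.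
by rewrite /simple -/(minnormal M M); move: minT; rewrite (group_inj TM).
Qed.

(** If [a != 1] and both [a] and [a ^ g] lie in [R], the centraliser of [a ^ g] contains [R] and
    [R :^ g]. By maximality it is [R], so [g] normalises [R], and [R] is its own normaliser. *)
Lemma abelian_corefree_Frobenius G R :
  abelian R -> R :!=: 1 -> maximal R G -> gcore R G = 1 ->
  [Frobenius G with complement R].
Proof.
move=> abR ntR maxR core1.
have ltRG := maxgroupp maxR; have sRG := proper_sub ltRG.
have overR H : R \subset H -> H \subset G -> H :=: R \/ H :=: G by apply: maximal_over.
apply/andP; split; first by rewrite (proper_neq ltRG).
apply/normedTI_memJ_P; split=> //; first by rewrite setD_eq0 subG1.
move=> a g /setD1P[nta Ra] Gg; rewrite !inE conjg_eq1 nta /=.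
apply/idP/idP=> [Rag | Rg]; last by rewrite groupJ.
have sRC : R \subset 'C_G[a ^ g].
  by rewrite subsetI sRG; apply/subsetP=> y Ry; apply/cent1P; apply: (centsP abR).
have [CR|CG] := overR _ sRC (subsetIl _ _); last first.
  case/negP: nta; rewrite -(conjg_eq1 a g) -cycle_eq1.
  rewrite (corefree_eq1 core1 (_ : <[a ^ g]>%G \subset R)) ?cycle_subG //.
  by rewrite cents_norm // cent_cycle -{1}CG subsetIr.
have Ng : g \in 'N_G(R).
  rewrite inE Gg inE -{2}CR subsetI -{1}(conjGid Gg) conjSg sRG /=.
  rewrite cent1J conjSg; apply/subsetP=> y Ry; apply/cent1P; exact: (centsP abR).
have sRN : R \subset 'N_G(R) by rewrite subsetI sRG normG.
have [NR|NG] := overR _ sRN (subsetIl _ _); first by rewrite -NR.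
by case/negP: ntR; rewrite (corefree_eq1 core1 (subxx R)) // -{1}NG subsetIr.
Qed.

(** Let [K] be the Frobenius kernel. A nonabelian [M] cannot meet [K] trivially, as [G / K] is
    abelian; so [M] lies in [K] and avoids [R], against [nonabelian_minnormal_meet]. *)
Lemma abelian_maximal_minnormal G R M :
  abelian R -> R :!=: 1 -> maximal R G -> gcore R G = 1 ->
  minnormal M G -> M \subset G -> abelian M.
Proof.
move=> abR ntR maxR core1 minM sMG; apply/negPn/negP=> nabM.
have [_ ntB] := nonabelian_minnormal_meet (abelian_sol abR) ntR maxR core1 minM sMG nabM.
have /mingroupP[/andP[ntM nMG] minM'] := minM.
have [K /andP[/eqP defG _]] := Frobenius_kernel_exists (abelian_corefree_Frobenius abR ntR maxR core1).
have [nsKG _ defKR _ tiKR] := sdprod_context defG.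
have nKG := normal_norm nsKG.
have [MK1|ntMK] := eqVneq (M :&: K) 1.
  case/negP: nabM; rewrite /abelian (sameP commG1P trivgP) -MK1 subsetI commg_subl normG /=.
  have nKM := subset_trans sMG nKG.
  rewrite -quotient_cents2 //.
  have abGK: abelian (G / K) by rewrite -defKR quotientMidl quotient_abelian.
  exact: abelianS (quotientS K sMG) abGK.
have MK : M :&: K = M by apply: minM'; rewrite ?subsetIl //= ntMK normsI.
by case/negP: ntB; rewrite -subG1 -tiKR setSI // -MK subsetIr.
Qed.

End Socle.

(** * Passing to the quotient by the core of the maximal subgroup *)

Section Core.
Variable aT : finGroupType.
Implicit Types G R M A L H E P Q T N : {group aT}.

Lemma gcore_quotient G R : R \subset G -> gcore (R / gcore R G) (G / gcore R G) = 1.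
Proof.
move=> sRG; set N := gcore R G.
have nsNG : N <| G := gcore_normal sRG.
have sR'G' : R / N \subset G / N by rewrite quotientS.
have [A defA sNA nsAG] := inv_quotientN nsNG (gcore_normal sR'G').
have sAR : A \subset R.
  rewrite -(quotientSGK (_ : A \subset 'N(N)) (gcore_sub R G)); last first.
    exact: subset_trans (normal_sub nsAG) (normal_norm nsNG).
  by rewrite -/N -defA gcore_sub.
have sAN : A \subset N by rewrite gcore_max // normal_norm.
apply/trivgP; rewrite /= defA; apply: subset_trans (quotientS _ sAN) _.
by rewrite trivg_quotient.
Qed.

(* Intended for N the core of R in G; the last two fields say that R / N acts
   irreducibly on M / N and that 'O_p(R / N) = 1. *)
Record abelian_socle (p : nat) N M R G : Prop := AbelianSocle {
  asoc_normal : M <| G;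
  asoc_sub : N \subset M;
  asoc_neq : M :!=: N;
  asoc_meet : M :&: R = N;
  asoc_mul : M * R = G;
  asoc_abelem : p.-abelem (M / N);
  asoc_pr : prime p;
  asoc_irr : forall A, N \subset A -> A \subset M -> R \subset 'N(A) -> A :=: N \/ A :=: M;
  asoc_pcore : forall A, N \subset A -> A <| R -> p.-group (A / N) -> A :=: N
}.

(** [R / N] is maximal and core-free in [G / N]; the alternatives are a nonabelian and an abelian
    minimal normal subgroup of [G / N]. *)
Lemma maximal_core_cases G R :
  solvable R -> maximal R G -> ~~ (R <| G) -> (forall p, logn p #|R| <= 1) ->
  (~~ abelian (R / gcore R G) /\ almost_simple (G / gcore R G)) \/
  exists p M, abelian_socle p (gcore R G) M R G.
Proof.
move=> solR maxR nRG sqf.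
have sRG : R \subset G by case/maxgroupP: maxR => /proper_sub.
have core1 := gcore_quotient sRG.
have nsNG := gcore_normal sRG.
pose N := gcore R G; rewrite -!/N.
have sNR : N \subset R by apply: gcore_sub.
have nsNR : N <| R := normalS sNR sRG nsNG.
have [nNG nNR] := (normal_norm nsNG, normal_norm nsNR).
have maxR' : maximal (R / N) (G / N) by rewrite quotient_maximal.
have solR' : solvable (R / N) by apply: quotient_sol.
have ntR' : (R / N)%G :!=: 1.
  rewrite -subG1 quotient_sub1 //; apply: contra nRG => sRN.
  by rewrite (_ : R = N :> {set aT}) //; apply/eqP; rewrite eqEsubset sRN.
have sqf' p : logn p #|R / N| <= 1.
  by apply: leq_trans (sqf p); rewrite dvdn_leq_log // dvdn_quotient.
have ntG' : (G / N)%G :!=: 1.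
  apply: contra ntR' => /eqP G1; rewrite -subG1 -[1]G1; exact: quotientS.
have [M' minM' sM'G'] := minnormal_exists ntG' (normG _).
have [abM'|nabM'] := boolP (abelian M'); last first.
  left; split; last first.
    exact: (nonabelian_minnormal_almost_simple solR' ntR' maxR' core1 sqf' minM' sM'G' nabM').
  apply: contra nabM' => abR'; exact: (abelian_maximal_minnormal abR' ntR' maxR' core1 minM' sM'G').
right; have /mingroupP[/andP[ntM' nM'G'] minM1] := minM'.
have [_ _ /is_abelemP[p p_pr abelM']] := minnormal_solvable minM' (subxx _) (abelian_sol abM').
have nsM'G' : M' <| G / N by rewrite /normal sM'G'.
have [M defM' sNM nsMG] := inv_quotientN nsNG nsM'G'.
have [sMG nMG] := andP nsMG.
have nNM := subset_trans sMG nNG.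
have defG : M * R = G.
  case: (maximal_mulg_norm maxR sMG (subset_trans sRG nMG)) => // sMR.
  by case/negP: ntM'; rewrite defM' -subG1 quotient_sub1 // gcore_max.
have sM1N : M^`(1) \subset N by rewrite der1_min // -defM'.
(* [M :&: R] contains [N], hence the derived subgroup of [M], so both [M] and [R] normalise it and
   it lies in the core. *)
have MR_N : M :&: R = N.
  apply/eqP; rewrite eqEsubset subsetI sNM sNR !andbT gcore_max ?subsetIr //.
  rewrite -{1}defG mul_subG //; last by rewrite normsI ?normG // (subset_trans sRG).
  by rewrite normal_norm // sub_der1_normal ?subsetIl // (subset_trans sM1N) // subsetI sNM.
have irr A : N \subset A -> A \subset M -> R \subset 'N(A) -> A :=: N \/ A :=: M.
  move=> sNA sAM nAR; case: (maximal_mulg_norm maxR (subset_trans sAM sMG) nAR) => [sAR|AR].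
    by left; apply/eqP; rewrite eqEsubset sNA -MR_N subsetI sAM sAR.
  right; have := group_modl R sAM; rewrite AR (setIidPr sMG) setIC MR_N.
  by rewrite mulGSid.
exists p, M; split=> //; first 1 last.
- by rewrite -defM'.
- move=> A sNA nsAR pA; have [sAR nAR] := andP nsAR.
  have nNA := subset_trans sAR nNR.
  have sA'R' : A / N \subset R / N by rewrite quotientS.
  have nAM' : A / N \subset 'N(M').
    by apply: subset_trans nM'G'; rewrite quotientS // (subset_trans sAR).
  have pM' : p %| #|M'|.
    by have [_ ? _] := pgroup_pdiv (abelem_pgroup abelM') ntM'.
  (* The fixed points of [A / N] on [M / N] are nontrivial and [G]-invariant, so by minimality
     [A / N] centralises [M / N]. Then [A / N] is normal in [G / N] and lies in a trivial core. *)
  have ntC := pgroup_subcent_neq1 pA nAM' p_pr pM'.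
  have nAR' : R / N \subset 'N(A / N) by rewrite quotient_norms.
  have nCG : G / N \subset 'N('C_M'(A / N)).
    rewrite -defG quotientMl // -defM' mul_subG //.
      by apply: cents_norm; apply: subset_trans abM' (centS (subsetIl _ _)).
    by rewrite normsI ?norms_cent // (subset_trans _ nM'G') // quotientS.
  have CM : 'C_M'(A / N) = M' by apply: minM1; rewrite ?subsetIl //= ntC.
  have nA'G' : G / N \subset 'N(A / N).
    rewrite -defG quotientMl // -defM' mul_subG // cents_norm // -CM subsetIr //.
  have A1 : (A / N)%G :=: 1 by apply: (corefree_eq1 core1).
  apply/eqP; rewrite eqEsubset sNA andbT -quotient_sub1 //= .
  by move: A1 => /= ->.
by apply: contra ntM' => /eqP MN; rewrite defM' MN trivg_quotient.
Qed.
End Core.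

(** * Factorisations G = R L and double cosets *)

Section DoubleCosets.
Variable aT : finGroupType.
Implicit Types G R M A L H E P Q T N K X : {group aT}.

(** Conjugation sends [G] into [Aut N], abelian for cyclic [N]. *)
Lemma der1_sub_cent_cyclic G N : cyclic N -> G \subset 'N(N) -> G^`(1) \subset 'C(N).
Proof.
move=> cycN nNG; rewrite -(ker_conj_aut N) ker_trivg_morphim /=.
rewrite (subset_trans (der_sub 1 G)) //= morphim_der //.
have abA : abelian (conj_aut N @* G).
  exact: abelianS (Aut_conj_aut _ _) (Aut_cyclic_abelian cycN).
by rewrite (derG1P abA).
Qed.

(* [M, R]N is R-invariant, so it is M; and G' centralises the cyclic group N. *)
Lemma socle_sub_cent p G R N M :
  ~~ (R <| G) -> N <| G -> cyclic N -> abelian_socle p N M R G -> M \subset 'C(N).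
Proof.
move=> nRG nsNG cycN soc.
have [[sMG nMG] [sNG nNG]] := (andP (asoc_normal soc), andP nsNG).
have defG := asoc_mul soc.
have sRG : R \subset G by rewrite -defG mulG_subr.
have nMR := subset_trans sRG nMG.
have sNR : N \subset R by rewrite -(asoc_meet soc) subsetIr.
have sA : (N <*> [~: M, R])%G \subset M.
  by rewrite join_subG (asoc_sub soc) commg_subl.
have nA : R \subset 'N((N <*> [~: M, R])%G).
  by rewrite normsY ?commg_normr // (subset_trans sRG).
have [AN|AM] := asoc_irr soc (joing_subl _ _) sA nA.
  case/negP: nRG; rewrite /normal sRG /= -{1}defG mul_subG ?normG //.
  rewrite -commg_subr; apply: subset_trans sNR; rewrite -AN joing_subr //.
rewrite -AM join_subG; apply/andP; split; first exact: cyclic_abelian.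
by apply: subset_trans (der1_sub_cent_cyclic cycN nNG); rewrite commgSS.
Qed.

Lemma index_prime_mul E H K :
  abelian E -> H \subset E -> K \subset E -> prime #|E : H| -> #|K| = #|H| ->
  K :!=: H -> H * K = E.
Proof.
move=> abE sHE sKE prE oK neKH; have cE := sub_abelian_cent2 abE.
have maxH := p_index_maximal sHE prE.
have nKH : H \subset 'N(K) by rewrite cents_norm ?cE.
have [sKH|<-] := maximal_mulg_norm maxH sKE nKH.
  by case/negP: neKH; rewrite eqEcard sKH oK leqnn.
by apply: centC; apply: cE.
Qed.

Section Factorization.
Variables G R L : {group aT}.
Hypotheses (tiRL : R :&: L = 1) (defG : R * L = G).

Let sLG : L \subset G. Proof. by rewrite -defG mulG_subr. Qed.
Let sRG : R \subset G. Proof. by rewrite -defG mulG_subl. Qed.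
Let oG : #|G| = (#|R| * #|L|)%N. Proof. by rewrite -defG TI_cardMg. Qed.

(** [H] and [H :^ y^-1] are distinct of the same prime index in [E], so [E] is their product; moved
    past [y], the second factor becomes an element of [H]. *)
Lemma conj_in_double_coset E H y :
  abelian E -> E <| G -> H \subset E -> H \subset L -> prime #|E : H| ->
  y \in G -> H :^ y != H ->
  forall e, e \in E -> exists l1 l2, [/\ l1 \in L, l2 \in L & e * y = l1 * y * l2].
Proof.
move=> abE /andP[sEG nEG] sHE sHL prE Gy neH e Ee.
have defE : H * (H :^ y^-1)%G = E.
  apply: index_prime_mul; rewrite ?cardJg //.
    by rewrite -(normsP nEG y^-1) ?groupV // conjSg.
  by apply: contra neH => /eqP {1}<-; rewrite /= conjsgKV.
move: Ee; rewrite -defE => /mulsgP[h _ Hh /imsetP[k Hk ->] ->].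
exists h, k; rewrite !(subsetP sHL) //; split=> //.
by rewrite conjgE invgK !mulgA mulgKV.
Qed.

(** * A normal abelian [p]-subgroup complementing [R] *)

Section Complement.
Variables (p : nat) (E : {group aT}).
Hypotheses (p_pr : prime p) (nsEG : E <| G) (abE : abelian E) (pE : p.-group E).
Hypotheses (tiER : E :&: R = 1) (defG' : E * R = G) (neLE : L :!=: E).
Hypothesis (sqf : logn p #|R| <= 1).

Let P := (E <*> L)%G.
Let X := (P :&: R)%G.
Let H := (E :&: L)%G.

Let oL : #|L| = #|E|.
Proof.
have := oG; rewrite -defG' TI_cardMg // mulnC => /eqP.
by rewrite eqn_pmul2l ?cardG_gt0 // => /eqP.
Qed.

Lemma compl_irr A : A \subset E -> maximal R G -> R \subset 'N(A) -> A :=: 1 \/ A :=: E.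
Proof.
move=> sAE maxR nAR.
have [sAR|AR] := maximal_mulg_norm maxR (subset_trans sAE (normal_sub nsEG)) nAR.
  by left; apply/trivgP; rewrite -tiER subsetI sAE.
right; have := group_modl R sAE; rewrite AR setIC tiER mulg1.
by rewrite (setIidPr (normal_sub nsEG)) => ->.
Qed.

(** [L] and [E] have the same order, so [P = E L] is a [p]-group, and [P = E X] by Dedekind. [X] is
    nontrivial because [L] differs from [E], and has order [p] because [p ^ 2] does not divide
    [#|R|]. *)
Lemma compl_structure :
  [/\ #|X| = p, #|E : H| = p, P = L * X :> {set aT} & P = L * E :> {set aT}].
Proof.
have [sEG nEG] := andP nsEG.
have defP : P = E * L :> {set aT} by rewrite /P /= norm_joinEr // (subset_trans sLG).
have defPX : P = E * X :> {set aT}.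
  rewrite /X /= setIC group_modl ?joing_subl // defG'.
  by apply/esym/setIidPr; rewrite join_subG sEG.
have pL : p.-group L by rewrite /pgroup oL.
have pP : p.-group P by rewrite defP pgroupM pE.
have pX : p.-group X by apply: pgroupS pP; apply: subsetIl.
have tiEX : E :&: X = 1 by apply/trivgP; rewrite -tiER setIS // subsetIr.
have oP : #|P| = (#|E| * #|X|)%N by rewrite defPX TI_cardMg.
have oX : #|X| = p.
  have ntX : X :!=: 1.
    apply: contraNneq neLE => X1; rewrite eqEcard oL leqnn andbT.
    by rewrite -[E : {set _}]mulg1 -X1 -defPX joing_subr.
  have [_ pX' _] := pgroup_pdiv pX ntX.
  have [[|n] oXn] := p_natP pX; first by rewrite (card1_trivg oXn) eqxx in ntX.
  have := leq_trans (dvdn_leq_log p (cardG_gt0 R) (cardSg (subsetIr P R))) sqf.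
  by rewrite -/X oXn pfactorK //; case: n oXn => // ->; rewrite expn1.
have sXR : X \subset R := subsetIr _ _.
have tiLX : L :&: X = 1.
  by apply/trivgP; rewrite -tiRL subsetI (subset_trans (subsetIr _ _)) ?subsetIl.
split=> //.
- have := mul_cardG E L; rewrite -defP oP oL oX => /eqP.
  rewrite -mulnA eqn_pmul2l ?cardG_gt0 // => /eqP oE.
  by rewrite -divgS ?subsetIl //= oE mulnK ?cardG_gt0.
- apply/eqP; rewrite eq_sym eqEcard mul_subG ?joing_subr ?subsetIl //=.
  by rewrite TI_cardMg // oL -oP.
by rewrite defP; apply/esym/normC; apply: subset_trans sLG nEG.
Qed.

(** Writing [x^-1 = l e] gives [y ^ x = l (e y e^-1) l^-1]. The middle factor is in [E y], which
    [conj_in_double_coset] places in [L y L]. *)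
Lemma compl_double_coset y x :
  y \in R -> H :^ y != H -> x \in X ->
  exists l1 l2, [/\ l1 \in L, l2 \in L & y ^ x = l1 * y * l2].
Proof.
have [oX oEH defP defP'] := compl_structure => Ry neH Xx.
have Gy := subsetP sRG y Ry; have [sEG nEG] := andP nsEG.
have: x^-1 \in P by rewrite groupV (subsetP (subsetIl _ _) _ Xx).
rewrite defP' => /mulsgP[l e Ll Ee def_x].
have Ee' : e * e^-1 ^ y^-1 \in E.
  by rewrite groupM // memJ_norm ?groupV // (subsetP nEG) ?groupV.
have prE : prime #|E : H| by rewrite oEH.
have [l1 [l2 [Ll1 Ll2 def_e]]] :=
  conj_in_double_coset abE nsEG (subsetIl E L) (subsetIr E L) prE Gy neH Ee'.
exists (l * l1), (l2 * l^-1); rewrite !groupM ?groupV //; split=> //.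
have def_x' : x = e^-1 * l^-1 by rewrite -[LHS]invgK def_x invMg.
have def_y : e * y * e^-1 = l1 * y * l2 by rewrite -def_e conjgE invgK !mulgA mulgKV.
rewrite conjgE def_x def_x'; transitivity (l * (e * y * e^-1) * l^-1); first by rewrite !mulgA.
by rewrite def_y !mulgA.
Qed.

End Complement.

Hypotheses (coreL : forall A, A <| G -> A \subset L -> A :=: 1).
Hypothesis nRG : ~~ (R <| G).
Hypothesis (sqf : forall p, logn p #|R| <= 1).

(** [M] is nilpotent, since its derived subgroup lies in the central subgroup [N]; [E] is its Sylow
    [p]-subgroup. Counting gives [#|L| = #|M : N|], so [L] is a [p]-group. The two outcomes
    correspond to [p] not dividing, or dividing, [#|N|]; in the latter [N0] is the Sylow
    [p]-subgroup of [N]. *)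
Lemma socle_compl_or_cofactor p N M :
  N <| G -> cyclic N -> abelian_socle p N M R G ->
  (exists E, [/\ E <| G, abelian E, p.-group E, E :&: R = 1 & E * R = G]
     /\ [/\ L :!=: E, p %| #|R|, ~~ (p %| #|N|) & E \subset M])
  \/ (exists E N0, [/\ E <| G, abelian E, N0 \subset N & #|N0| = p]
     /\ [/\ N0 * L = E, N0 :&: L = 1, p.-group E & E \subset M]).
Proof.
move=> nsNG cycN soc; have p_pr := asoc_pr soc.
have nsMG := asoc_normal soc; have [sMG nMG] := andP nsMG.
have [sNG nNG] := andP nsNG; have sNM := asoc_sub soc.
have cNM := socle_sub_cent nRG nsNG cycN soc.
have nNM := subset_trans sMG nNG.
have sNR : N \subset R by rewrite -(asoc_meet soc) subsetIr.
have sM1N : M^`(1) \subset N by rewrite der1_min // (abelem_abelian (asoc_abelem soc)).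
have nilM : nilpotent M.
  rewrite -quotient_center_nil abelian_nil // sub_der1_abelian //.
  by rewrite (subset_trans sM1N) // subsetI sNM centsC.
pose E := 'O_p(M)%G.
have sylE : p.-Sylow(M) E := nilpotent_pcore_Hall p nilM.
have nsEG : E <| G by apply: gFnormal_trans.
have sEM : E \subset M by apply: pcore_sub.
have pE : p.-group E by apply: pcore_pgroup.
have oM : #|M| = (#|L| * #|N|)%N.
  have := mul_cardG M R; rewrite (asoc_mul soc) (asoc_meet soc) oG => /eqP.
  by rewrite -mulnA mulnC eqn_pmul2l ?cardG_gt0 // => /eqP.
have pL : p.-group L.
  have := abelem_pgroup (asoc_abelem soc).
  by rewrite /pgroup card_quotient // -divgS // oM mulnK ?cardG_gt0.
have ntL : L :!=: 1.
  apply: contraNneq nRG => L1.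
  by rewrite (_ : R = G) // ?normal_refl //; apply/val_inj; rewrite /= -defG L1 mulg1.
have [pN|p'N] := boolP (p %| #|N|); [right | left].
  have lR : logn p #|N| = 1%N.
    apply/eqP; rewrite eqn_leq logn_gt0 mem_primes p_pr cardG_gt0 pN !andbT.
    by apply: leq_trans (sqf p); rewrite dvdn_leq_log ?cardSg.
  have lRN : logn p #|R : N| = 0%N.
    by have := sqf p; rewrite -(Lagrange sNR) lognM ?indexg_gt0 ?cardG_gt0 // lR; case: logn.
  pose N0 := 'O_p(N)%G.
  have sylN0 : p.-Sylow(N) N0 := nilpotent_pcore_Hall p (abelian_nil (cyclic_abelian cycN)).
  have oN0 : #|N0| = p by rewrite (card_Hall sylN0) p_part lR expn1.
  have oE : #|E| = (p * #|L|)%N.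
    by rewrite (card_Hall sylE) oM partnM ?cardG_gt0 // part_pnat_id // p_part lR expn1 mulnC.
  have sylEG : p.-Sylow(G) E.
    rewrite pHallE (normal_sub nsEG) /= oE oG partnM ?cardG_gt0 // (part_pnat_id pL).
    rewrite p_part -(Lagrange sNR) lognM ?cardG_gt0 ?indexg_gt0 // lR lRN addn0 expn1 //.
  have sLE : L \subset E by rewrite (sub_normal_Hall sylEG nsEG).
  have sN0N : N0 \subset N by apply: pcore_sub.
  have tiN0L : N0 :&: L = 1.
    by apply/trivgP; rewrite -tiRL setSI // (subset_trans sN0N).
  have defE : N0 * L = E.
    apply/eqP; rewrite eqEcard mul_subG //=.
      by rewrite TI_cardMg // oN0 oE.
    by rewrite (sub_normal_Hall sylE) ?pcore_normal ?pcore_pgroup // (subset_trans sN0N).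
  exists E, N0; split; split=> //.
  (* [L] is abelian because its derived subgroup lies in [N], hence in [R :&: L = 1]; and [M]
     centralises [N0]. *)
  rewrite /E -/(gval E) -defE abelianM (abelianS sN0N (cyclic_abelian cycN)) /=.
    apply/andP; split.
      apply/derG1P/trivgP; rewrite -tiRL subsetI der_sub andbT.
      by apply: subset_trans sNR; apply: subset_trans sM1N; rewrite dergS // (subset_trans sLE).
    by rewrite (subset_trans sLE) // (subset_trans sEM) // (subset_trans cNM) ?centS.
have oE : #|E| = #|L|.
  rewrite (card_Hall sylE) oM partnM ?cardG_gt0 // part_pnat_id // part_p'nat ?muln1 //.
  by rewrite p'natE.
have tiEN : E :&: N = 1.
  by rewrite coprime_TIg // (pnat_coprime pE) // p'natE.
have tiER : E :&: R = 1.
  by apply/trivgP; rewrite -tiEN -(asoc_meet soc) setIA subsetI subsetIr andbT subsetI subsetIl subIset ?sEM.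
have defG' : E * R = G.
  apply/eqP; rewrite eqEcard mul_subG ?(normal_sub nsEG) //=.
  by rewrite TI_cardMg // oE oG mulnC.
have neLE : L :!=: E.
  apply: contra ntL => /eqP LE; apply/eqP; apply: coreL => //.
  by rewrite (group_inj LE).
have abE : abelian E.
  apply/derG1P/trivgP; rewrite -tiEN subsetI der_sub.
  by apply: subset_trans sM1N; rewrite dergS.
exists E; split; split=> //.
(* If [p] did not divide [#|R|], the normal subgroup [E] would be a Sylow [p]-subgroup of [G],
   containing the [p]-group [L] of the same order. *)
apply: contraR neLE => p'R.
have sylEG : p.-Sylow(G) E.
  rewrite pHallE (normal_sub nsEG) /= oE oG partnM ?cardG_gt0 // (part_pnat_id pL).
  by rewrite part_p'nat ?mul1n // p'natE.
by rewrite eqEcard oE leqnn andbT (sub_normal_Hall sylEG).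
Qed.

End Factorization.
End DoubleCosets.

(** * Automorphisms preserving S *)

Section Symmetries.
Variable aT : finGroupType.
Implicit Types (G R M A L H E P Q T N K X D Z : {group aT}) (S : {set aT}).

(** The condition that [Aut(R)_S] is nontrivial, for a subgroup [R] of any ambient group;
    [symmetry_AutS] translates it back to [AutS]. *)
Definition has_symmetry (R S : {set aT}) : Prop :=
  exists a : {perm aT}, [/\ a \in Aut R, a != 1 & a @: S = S].

Lemma symmetry_sub R S (a : {perm aT}) x :
  a \in Aut R -> x \in R -> a x != x -> (forall y, y \in S -> a y \in S) ->
  has_symmetry R S.
Proof.
move=> AutRa Rx ax aS; exists a; split=> //.
  by apply: contraNneq ax => ->; rewrite perm1.
apply/eqP; rewrite eqEcard card_imset ?leqnn ?andbT; last exact: perm_inj.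
by apply/subsetP=> _ /imsetP[y Sy ->]; apply: aS.
Qed.

Lemma symmetry_conj R S s :
  S \subset R -> s \in 'N(R) -> s \notin 'C(R) ->
  (forall y, y \in S -> y ^ s \in S) -> has_symmetry R S.
Proof.
move=> sSR nRs ncRs Ss.
have [x Rx neq] : exists2 x, x \in R & x ^ s != x.
  apply/exists_inP; apply: contraR ncRs => /exists_inPn fix_s.
  apply/centP=> x Rx; apply: esym; rewrite conjgC.
  by have /negPn/eqP-> := fix_s x Rx.
apply: (@symmetry_sub R S (conj_aut R s) x) => //.
- by rewrite Aut_aut.
- by rewrite norm_conj_autE.
by move=> y Sy; rewrite norm_conj_autE ?Ss // (subsetP sSR).
Qed.

Lemma odd_invg_neq H a : odd #|H| -> a \in H -> a != 1 -> a^-1 != a.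
Proof.
move=> oddH Ha nta; apply: contra nta => /eqP aV.
have a2 : a ^+ 2 = 1 by rewrite expgS expg1 -{1}aV mulVg.
have : #[a] <= 2 by rewrite dvdn_leq // order_dvdn a2.
have : odd #[a] by rewrite (dvdn_odd (order_dvdG Ha)).
by rewrite -order_eq1; have := order_gt0 a; case: #[a] => [|[|[|n]]].
Qed.

(** The automorphism is [a b -> a^-1 b^s] on [Q \x D]; it moves [Q] since [#|Q|] is odd. *)
Lemma symmetry_inv_conj R Q D S s :
  Q \x D = R -> abelian Q -> odd #|Q| -> Q :!=: 1 -> s \in D -> S \subset R ->
  (forall a b, a \in Q -> b \in D -> a * b \in S -> a^-1 * b ^ s \in S) ->
  has_symmetry R S.
Proof.
move=> defR abQ oddQ ntQ Ds sSR Ss.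
have [_ defR' cQD tiQD] := dprodP defR.
have invM : {in Q &, {morph (fun x : aT => x^-1) : x y / x * y}}.
  by move=> x y Qx Qy; rewrite -invMg (centsP abQ x Qx y Qy).
pose fQ := Morphism invM.
have imQ : fQ @* Q = Q.
  apply/eqP; rewrite eqEcard card_injm ?leqnn ?andbT //.
    by apply/subsetP=> _ /morphimP[x _ Qx ->]; rewrite /= groupV.
  by apply/injmP=> x y _ _ /invg_inj.
pose fD := conjgm_morphism D s.
have imD : fD @* D = D.
  by rewrite morphim_conj setIid conjGid.
have cf : fD @* D \subset 'C(fQ @* Q) by rewrite imQ imD.
pose f := dprodm defR cf.
have injf : 'injm f.
  rewrite injm_dprodm imQ imD tiQD eqxx injm_conj !andbT.
  by apply/injmP=> x y _ _ /invg_inj.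
have imf : f @* R = R.
  by rewrite im_dprodm imQ imD.
have fE a b : a \in Q -> b \in D -> f (a * b) = a^-1 * b ^ s.
  by move=> Qa Db; apply: (dprodmE defR cf Qa Db).
have autE' a b : a \in Q -> b \in D -> aut injf imf (a * b) = a^-1 * b ^ s.
  move=> Qa Db; have Rab : a * b \in R by rewrite -defR' mem_mulg.
  exact: etrans (autE injf imf Rab) (fE a b Qa Db).
have [a Qa nta] := trivgPn _ ntQ.
apply: (@symmetry_sub R S (aut injf imf) a); first exact: Aut_aut.
- by rewrite -defR' -[a]mulg1 mem_mulg.
- by rewrite -{1}[a]mulg1 autE' // conj1g mulg1 (odd_invg_neq oddQ).
move=> y Sy; have := subsetP sSR y Sy; rewrite -defR' => /mulsgP[b c Qb Dc def_y].
by rewrite def_y autE' // Ss // -def_y.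
Qed.

(** The map is [i -> 2 c - i] on [Z/r], with [r - i] avoiding truncated subtraction. For [r] at most
    5 a subset or its complement has at most two points, and is symmetric about their midpoint; the
    proof enumerates all subsets. *)
Lemma reflection_nat (f : nat -> bool) r : (r == 3) || (r == 5) ->
  exists2 c, c < r & forall i, i < r -> f i -> f ((c + c + (r - i)) %% r).
Proof.
move=> r35.
have: has (fun c => all (fun i => f i ==> f ((c + c + (r - i)) %% r)) (iota 0 r)) (iota 0 r).
  case/orP: r35 => /eqP->; cbv.
    by case: (f 0%N); case: (f 1%N); case: (f 2%N).
  by case: (f 0%N); case: (f 1%N); case: (f 2%N); case: (f 3%N); case: (f 4%N).
case/hasP=> c; rewrite mem_iota add0n => /andP[_ ltcr] /allP fP.
exists c => // i ltir fi; have := fP i; rewrite mem_iota add0n ltir => /(_ isT).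
by rewrite fi.
Qed.

(** Working form of a dihedral group: [Z] is the rotation subgroup, and elements of [D] outside it
    are the reflections. *)
Record dihedral_pair (r : nat) D Z : Prop := DihedralPair {
  dih_sub : Z \subset D;
  dih_card : #|D| = (2 * r)%N;
  dih_cardZ : #|Z| = r;
  dih_pr : prime r;
  dih_odd : odd r;
  dih_invol : forall b, b \in D -> b \notin Z -> b * b = 1;
  dih_inv : forall b z, b \in D -> b \notin Z -> z \in Z -> z ^ b = z^-1
}.

(** The presentation supplies [x] and [y] with [#[x] <= r] and [#[y] <= 2]; [#|D| = 2 r] forces
    equalities, and [Z] is generated by [x]. *)
Lemma isog_dihedral_pair r D : prime r -> odd r -> D \isog 'D_(2 * r) -> exists Z, dihedral_pair r D Z.
Proof.
rewrite mul2n => r_pr odd_r isoD; have r_gt1 := prime_gt1 r_pr.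
have oD : #|D| = (2 * r)%N by rewrite (card_isog isoD) card_dihedral // mul2n.
have : D \homg 'D_r.*2 by apply: isog_hom.
rewrite (Grp_dihedral r_gt1) => /existsP[[x y]] /=; rewrite !xpair_eqE /= => /and4P[/eqP defD /eqP xr /eqP y2 /eqP xy].
have nXy : <[y]> \subset 'N(<[x]>).
  by rewrite cycle_subG inE -cycleJ xy cycleV.
have defXY : <[x]> * <[y]> = D by rewrite -norm_joinEr // -defD.
have oy : #[y] <= 2 by rewrite dvdn_leq // order_dvdn y2.
have ox : #[x] <= r by rewrite dvdn_leq ?prime_gt0 // order_dvdn xr.
have le : 2 * r <= #[x] * #[y].
  have := mul_cardG <[x]> <[y]>; rewrite defXY oD /order => ->.
  by rewrite leq_pmulr ?cardG_gt0.
have ox' : #[x] = r.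
  apply/eqP; rewrite eqn_leq ox /= -(leq_pmul2l (isT : 0 < 2)).
  by rewrite (leq_trans le) // mulnC leq_mul2r oy orbT.
have oy' : #[y] = 2.
  apply/eqP; rewrite eqn_leq oy /= -(leq_pmul2l (prime_gt0 r_pr)).
  by rewrite mulnC (leq_trans le) // leq_mul2r ox orbT.
have XyV u : u \in <[x]> -> u ^ y = u^-1.
  by case/cycleP=> i ->; rewrite conjXg xy expgVn.
have outX b : b \in D -> b \notin <[x]> -> exists2 u, u \in <[x]> & b = u * y.
  rewrite -defXY => /mulsgP[u v Xu]; rewrite (cycle2g oy') => /set2P[] -> ->.
    by rewrite mulg1 Xu.
  by exists u.
exists <[x]>%G; split=> //; first by rewrite -defXY mulG_subl.
- move=> b Db Xb; have [u Xu ->] := outX b Db Xb.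
  by rewrite [X in _ * X]conjgC XyV // mulgA -(mulgA u) -expg2 y2 mulg1 mulgV.
move=> b z Db Xb Xz; have [u Xu ->] := outX b Db Xb.
rewrite conjgM (conjgE z u) (_ : z * u = u * z) ?mulKg ?XyV //.
exact: (centsP (cycle_abelian x)).
Qed.
End Symmetries.

(** * Reflections of a dihedral factor that preserve [S] *)

Section Reflections.
Variable aT : finGroupType.
Implicit Types (G R M A L H E P Q T N K X D Z : {group aT}) (S : {set aT}).

Section Dihedral.
Variables (r : nat) (D Z : {group aT}).
Hypothesis dihDZ : dihedral_pair r D Z.

Lemma dihedral_index : #|D : Z| = 2.
Proof.
rewrite -divgS ?(dih_sub dihDZ) // (dih_card dihDZ) (dih_cardZ dihDZ) mulnK //.
exact: prime_gt0 (dih_pr dihDZ).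
Qed.

Lemma dihedral_exists : exists2 s, s \in D & s \notin Z.
Proof.
apply/subsetPn/negP=> /subset_leq_card; rewrite (dih_card dihDZ) (dih_cardZ dihDZ).
by rewrite leqNgt -{1}[r]mul1n ltn_mul2r (prime_gt0 (dih_pr dihDZ)).
Qed.

Lemma dihedral_rcoset s b : s \in D -> s \notin Z -> b \in D -> b \notin Z -> b \in Z :* s.
Proof.
move=> Ds Zs Db Zb.
by rewrite (rcoset_index2 (dih_sub dihDZ) dihedral_index) ?inE ?Zb ?Zs.
Qed.

(** On the coset [Z s], conjugation by [w s] is thus the point reflection [z -> w^2 z^-1], which
    links [reflection_nat] to conjugation. *)
Lemma dihedral_conj s z w : s \in D -> s \notin Z -> z \in Z -> w \in Z ->
  (z * s) ^ (w * s) = w * w * z^-1 * s.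
Proof.
move=> Ds Zs Zz Zw; have sZD := dih_sub dihDZ.
have sC u : u \in Z -> s * u = u^-1 * s.
  by move=> Zu; rewrite [RHS]conjgC (dih_inv dihDZ) ?groupV ?invgK.
have s2 := dih_invol dihDZ Ds Zs.
have abZ : abelian Z by rewrite cyclic_abelian // prime_cyclic // (dih_cardZ dihDZ) (dih_pr dihDZ).
have e1 : s * w * s = w^-1 by rewrite sC // -mulgA s2 mulg1.
have e2 : s * (z * w^-1) = w * z^-1 * s by rewrite sC ?groupM ?groupV // invMg invgK.
have ws2 : (w * s)^-1 = w * s.
  by apply/eqP; rewrite eq_invg_mul -mulgA (mulgA s) e1 mulgV.
rewrite conjgE ws2; transitivity (w * (s * (z * (s * w * s)))); first by rewrite !mulgA.
by rewrite e1 e2 !mulgA.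
Qed.

(* For r = 3, 5 every subset of Z/r is symmetric about some point. *)
Lemma dihedral_reflection (T : {set aT}) : (r == 3) || (r == 5) ->
  exists s, [/\ s \in D, s \notin Z &
    forall b, b \in D -> b \notin Z -> b \in T -> b ^ s \in T].
Proof.
move=> r35; have [s0 Ds0 Zs0] := dihedral_exists.
have sZD := dih_sub dihDZ; have oZ := dih_cardZ dihDZ.
have /cyclicP[z0 defZ] : cyclic Z by rewrite prime_cyclic // oZ (dih_pr dihDZ).
have Zz0 : z0 \in Z by rewrite defZ cycle_id.
have oz0 : #[z0] = r by rewrite /order -defZ.
have [c ltcr fP] := reflection_nat (fun i => z0 ^+ i * s0 \in T) r35.
exists (z0 ^+ c * s0); split.
- by rewrite groupM // groupX // (subsetP sZD).
- by rewrite groupMl ?groupX.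
move=> b Db Zb Tb.
have /rcosetP[z Zz def_b] := dihedral_rcoset Ds0 Zs0 Db Zb.
move: Zz; rewrite defZ => /cyclePmin[i]; rewrite oz0 => ltir def_z.
move: Tb; rewrite def_b def_z => /(fP i ltir).
rewrite dihedral_conj ?groupX // -oz0 expg_mod_order oz0 !expgD.
suff -> : z0 ^+ (r - i) = (z0 ^+ i)^-1 by [].
by apply/eqP; rewrite eq_sym eq_invg_mul -expgD subnKC ?(ltnW ltir) // -oz0 expg_order.
Qed.

End Dihedral.

Section DirectProduct.
Variables (q r : nat) (R Q D Z : {group aT}) (L : {group aT}) (S : {set aT}).
Hypotheses (dihDZ : dihedral_pair r D Z) (r35 : (r == 3) || (r == 5)).
Hypotheses (defR : Q \x D = R) (abQ : abelian Q) (oddQ : odd #|Q|) (ntQ : Q :!=: 1).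
Hypotheses (sSR : S \subset R) (SV : forall x, x \in S -> x^-1 \in S).

Let sQR : Q \subset R. Proof. by have [_ <- _ _] := dprodP defR; rewrite mulG_subl. Qed.
Let sDR : D \subset R. Proof. by have [_ <- _ _] := dprodP defR; rewrite mulG_subr. Qed.
Let cQD a b : a \in Q -> b \in D -> a * b = b * a.
Proof. by have [_ _ cQD _] := dprodP defR => Qa Db; apply/esym/(centsP cQD). Qed.

(** The symmetry is [a b -> a^-1 b^s]. Outside ['N(L)] only the [D]-coordinate matters, by [fus];
    inside, [s] is chosen so that the map is inversion, and [S] is closed under inverses. If [Z]
    normalises [L], then [D] meets ['N(L)] in [Z], and a reflection [s] works. *)
Lemma symmetry_fusion_Q :
  ~~ (R \subset 'N(L)) -> Q \subset 'N(L) ->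
  (forall y n, y \in S -> y \notin 'N(L) -> n \in Q -> n * y \in S) ->
  has_symmetry R S.
Proof.
move=> nRL nQL fus; have sZD := dih_sub dihDZ.
have nZD : D \subset 'N(Z) := normal_norm (index2_normal sZD (dihedral_index dihDZ)).
have fixW s : s \in D ->
    (forall b, b \in D -> b \in 'N(L) -> b ^ s = b^-1) ->
    (forall b, b \in D -> b \notin 'N(L) -> b \in S -> b ^ s \in S /\ b ^ s \notin 'N(L)) ->
  has_symmetry R S.
  move=> Ds inW outW; apply: (symmetry_inv_conj defR abQ oddQ ntQ Ds sSR) => a b Qa Db Sab.
  have Na : a \in 'N(L) := subsetP nQL a Qa.
  have [Nb|nNb] := boolP (b \in 'N(L)).
    by rewrite (inW b) // -invMg -cQD // SV.
  have nNab : a * b \notin 'N(L) by rewrite groupMl.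
  have Sb : b \in S by rewrite -(mulKg a b) fus ?groupV.
  by have [Sbs nNbs] := outW b Db nNb Sb; rewrite fus ?groupV.
have [sZN|nsZN] := boolP (Z \subset 'N(L)).
  have inZ b : b \in D -> b \in 'N(L) -> b \in Z.
    move=> Db Nb; apply: contraR nRL => Zb.
    have [_ <- _ _] := dprodP defR; rewrite mul_subG //.
    apply/subsetP=> c Dc; have [Zc|Zc] := boolP (c \in Z); first exact: (subsetP sZN).
    have /rcosetP[z Zz ->] := dihedral_rcoset dihDZ Db Zb Dc Zc.
    by rewrite groupM // (subsetP sZN).
  have [s [Ds Zs sS]] := dihedral_reflection dihDZ S r35.
  apply: (fixW s Ds) => b Db.
    by move=> Nb; apply: (dih_inv dihDZ) => //; apply: inZ.
  move=> nNb Sb; have Zb : b \notin Z by apply: contra nNb; apply: (subsetP sZN).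
  split; first exact: sS.
  apply: contra Zb => /(inZ _ (groupJ Db Ds)).
  by rewrite memJ_norm // (subsetP nZD).
(* Now no nontrivial rotation normalises [L], as it would generate [Z]. Hence each element of [D] in
   ['N(L)] is its own inverse, and [s = 1] suffices. *)
apply: (fixW 1 (group1 D)) => b Db; last by rewrite conjg1.
rewrite conjg1 => Nb; have [Zb|Zb] := boolP (b \in Z); last first.
  by apply/eqP; rewrite eq_sym eq_invg_mul (dih_invol dihDZ).
have [-> | ntb] := eqVneq b 1; first by rewrite invg1.
case/negP: nsZN; suff -> : Z = <[b]> :> {set aT} by rewrite cycle_subG.
apply/eqP; rewrite eq_sym eqEcard cycle_subG Zb /= -/(order b).
have := order_dvdG Zb; rewrite (dih_cardZ dihDZ).
case/primeP: (dih_pr dihDZ) => _ pr_r /pr_r/pred2P[o1|->//].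
by rewrite -order_eq1 o1 in ntb.
Qed.

(** The symmetry is conjugation by a reflection [s] preserving [S] on [D] minus [Z]. It inverts [Z],
    and outside ['N(L)] it moves [y] within [Z y], which [fus] keeps in [S]. *)
Lemma symmetry_fusion_Z :
  (forall y, y \in R -> y \in 'N(L) -> y \in D) ->
  (forall y n, y \in S -> y \notin 'N(L) -> n \in Z -> n * y \in S) ->
  has_symmetry R S.
Proof.
move=> inD fus; have sZD := dih_sub dihDZ.
have nZD : D \subset 'N(Z) := normal_norm (index2_normal sZD (dihedral_index dihDZ)).
have [s [Ds Zs sS]] := dihedral_reflection dihDZ S r35.
have Rs := subsetP sDR s Ds.
apply: (symmetry_conj sSR (subsetP (normG R) s Rs)).
  have ntZ : Z :!=: 1 by rewrite -cardG_gt1 (dih_cardZ dihDZ) prime_gt1 ?(dih_pr dihDZ).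
  have [z Zz ntz] := trivgPn _ ntZ.
  have oddZ : odd #|Z| by rewrite (dih_cardZ dihDZ) (dih_odd dihDZ).
  apply: contra (odd_invg_neq oddZ Zz ntz) => /centP cs.
  rewrite -(dih_inv dihDZ Ds Zs Zz) conjgE -(cs z) ?mulKg //.
  by rewrite (subsetP sDR) ?(subsetP sZD).
move=> y Sy; have Ry := subsetP sSR y Sy.
have [Ny|nNy] := boolP (y \in 'N(L)).
  have Dy := inD y Ry Ny; have [Zy|Zy] := boolP (y \in Z); last exact: sS.
  by rewrite (dih_inv dihDZ) ?SV.
move: Ry; have [_ <- _ _] := dprodP defR => /mulsgP[a b Qa Db def_y].
have [n Zn def_bs] : exists2 n, n \in Z & b ^ s = n * b.
  have [Zb|Zb] := boolP (b \in Z).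
    by exists (b ^ s * b^-1); rewrite ?mulgKV // groupM ?groupV // memJ_norm ?(subsetP nZD).
  apply/rcosetP; apply: (dihedral_rcoset dihDZ Db Zb); first exact: groupJ.
  by rewrite memJ_norm // (subsetP nZD).
have aJ : a ^ s = a by rewrite conjgE (cQD Qa Ds) mulKg.
have -> : y ^ s = n * y.
  by rewrite def_y conjMg aJ def_bs !mulgA (cQD Qa (subsetP sZD n Zn)).
exact: fus.
Qed.

End DirectProduct.
End Reflections.

(** * The case C_q : C_r *)

Lemma almost_simple_quotient1 (aT : finGroupType) (G : {group aT}) :
  almost_simple (G / 1) -> almost_simple G.
Proof.
case=> T [nsTG simT nabT CT].
have inj1 : 'injm (coset (1 : {set aT})) by rewrite ker_coset.
have [T0 defT _ sT0] := inv_quotientN (normal1 G) nsTG.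
have n1 (A : {set aT}) : A \subset 'N(1) by rewrite norms1.
have isoT : T0 \isog T by rewrite defT quotient1_isog.
exists T0; split=> //.
- by rewrite (isog_simple isoT).
- by rewrite (isog_abelian isoT).
apply/trivgP; rewrite -(injmSK inj1) ?subIset ?n1 // morphim1.
by rewrite injm_subcent ?n1 // -/(G / 1) -/(T0 / 1) -defT CT.
Qed.

Section Symmetry.
Variable aT : finGroupType.
Implicit Types (G R M A L H E P Q T N K X D Z : {group aT}) (S : {set aT}).

Variables (G R L : {group aT}) (S : {set aT}).
Hypotheses (tiRL : R :&: L = 1) (defG : R * L = G).
Hypotheses (coreL : forall A, A <| G -> A \subset L -> A :=: 1).
Hypotheses (maxR : maximal R G) (sSR : S \subset R).
(* S is the trace on R of a union of L-double cosets. *)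
Hypothesis SL : forall x l1 l2,
  x \in S -> l1 \in L -> l2 \in L -> l1 * x * l2 \in R -> l1 * x * l2 \in S.

Let sLG : L \subset G. Proof. by rewrite -defG mulG_subr. Qed.
Let sRG : R \subset G. Proof. by rewrite -defG mulG_subl. Qed.

(** Otherwise [G = R L] normalises [L], which is then trivial by [coreL], so [R = G]. *)
Lemma maximal_not_norm_compl : ~~ (R \subset 'N(L)).
Proof.
apply/negP=> nLR; have /proper_neq/eqP[] := maxgroupp maxR.
have L1 : L :=: 1 by apply: coreL; rewrite // /normal sLG -defG mul_subG ?normG.
by rewrite -defG L1 mulg1.
Qed.

(** Conjugation by [l] in [L] keeps [y] in [L y L]; some [l] acts nontrivially, since otherwise [R]
    would normalise [L]. *)
Lemma normal_symmetry : R <| G -> has_symmetry R S.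
Proof.
move=> /andP[_ nRG]; have nRL := subset_trans sLG nRG.
have [l Ll ncl] : exists2 l, l \in L & l \notin 'C(R).
  apply/subsetPn; apply: contra maximal_not_norm_compl => cLR.
  by rewrite cents_norm // centsC.
apply: (symmetry_conj sSR (subsetP nRL l Ll) ncl) => y Sy.
rewrite conjgE mulgA SL ?groupV //.
by rewrite -mulgA -conjgE memJ_norm ?(subsetP nRL) ?(subsetP sSR).
Qed.

(** [compl_double_coset] puts [y ^ x] in [L y L] unless [y] normalises [E :&: L]; [hfix] isolates
    this exception. *)
Lemma compl_symmetry p E :
  prime p -> E <| G -> abelian E -> p.-group E -> E :&: R = 1 -> E * R = G ->
  L :!=: E -> logn p #|R| <= 1 ->
  (forall y x, y \in S -> (E :&: L) :^ y = E :&: L -> x \in (E <*> L) :&: R -> y ^ x \in S) ->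
  ~~ ((E <*> L) :&: R \subset 'C(R)) -> has_symmetry R S.
Proof.
move=> p_pr nsEG abE pE tiER defG' neLE sqf hfix /subsetPn[x Xx ncx].
have Rx := subsetP (subsetIr _ _) x Xx.
apply: (symmetry_conj sSR (subsetP (normG R) x Rx) ncx) => y Sy.
have Ry := subsetP sSR y Sy.
have [eqH|neqH] := eqVneq ((E :&: L) :^ y) (E :&: L); first exact: hfix.
have [l1 [l2 [Ll1 Ll2 def_y]]] :=
  compl_double_coset tiRL defG p_pr nsEG abE pE tiER defG' neLE sqf Ry neqH Xx.
by rewrite def_y SL // -def_y groupJ.
Qed.

(** [L] has prime index in [E], so [conj_in_double_coset] with [H = L] places [N0 y] inside
    [L y L]. *)
Lemma cofactor_fusion p E N0 :
  prime p -> E <| G -> abelian E -> N0 \subset R -> #|N0| = p ->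
  N0 * L = E -> N0 :&: L = 1 ->
  forall y n, y \in S -> y \notin 'N(L) -> n \in N0 -> n * y \in S.
Proof.
move=> p_pr nsEG abE sN0R oN0 defE tiN0L y n Sy nNy N0n.
have Ry := subsetP sSR y Sy.
have sLE : L \subset E by rewrite -defE mulG_subr.
have prE : prime #|E : L|.
  by rewrite -divgS // -defE TI_cardMg // oN0 mulnK ?cardG_gt0.
have neL : L :^ y != L by apply: contra nNy => /eqP eqL; rewrite inE eqL.
have En : n \in E by rewrite -defE (subsetP (mulG_subl _ _)).
have [l1 [l2 [Ll1 Ll2 def_y]]] :=
  conj_in_double_coset abE nsEG sLE (subxx L) prE (subsetP sRG y Ry) neL En.
by rewrite def_y SL // -def_y groupM // (subsetP sN0R).
Qed.

Lemma compl_norm E : E <| G -> abelian E -> (E <*> L) \subset 'N(E :&: L).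
Proof.
move=> /andP[_ nEG] abE; rewrite join_subG; apply/andP; split.
  by apply: cents_norm; apply: subset_trans abE (centS (subsetIl _ _)).
by rewrite normsI ?normG // (subset_trans sLG).
Qed.

Section Frobenius.
Variables (q r : nat) (K H : {group aT}).
Hypotheses (q_pr : prime q) (r_pr : prime r) (neqr : q != r).
Hypotheses (defR : K ><| H = R) (oK : #|K| = q) (oH : #|H| = r) (nabR : ~~ abelian R).

Let nsKR : K <| R. Proof. by have [] := sdprod_context defR. Qed.
Let oR : #|R| = (q * r)%N. Proof. by rewrite -(sdprod_card defR) oK oH. Qed.
Let prKR : prime #|R : K|.
Proof. by rewrite -divgS ?normal_sub // oR oK mulKn ?prime_gt0. Qed.
Let abK : abelian K. Proof. by rewrite cyclic_abelian // prime_cyclic ?oK. Qed.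
Let abH : abelian H. Proof. by rewrite cyclic_abelian // prime_cyclic ?oH. Qed.

Let overK A : K \subset A -> A \subset R -> A :=: K \/ A :=: R.
Proof. exact: maximal_over (p_index_maximal (normal_sub nsKR) prKR). Qed.

Let ncKR : ~~ (K \subset 'C(R)).
Proof.
apply: contra nabR => cKR; have [_ _ defKH _ _] := sdprod_context defR.
by rewrite -defKH abelianM abK abH centsC (subset_trans cKR) // centS // -defKH mulG_subr.
Qed.

(** If [N] meets [K] trivially, they centralise each other; a nontrivial [N] then gives [R = K N]
    with abelian factors. *)
Let normal_cases N : N <| R -> N :!=: R -> N :=: 1 \/ N :=: K.
Proof.
move=> nsNR neNR; have [KN1|ntKN] := eqVneq (K :&: N) 1; last first.
  right; have sKN : K \subset N.
    by apply: contraR ntKN => nsKN; rewrite prime_TIg ?oK.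
  by have [|/eqP] := overK sKN (normal_sub nsNR); rewrite ?(negPf neNR).
left; apply/eqP; apply: contraR nabR => ntN.
have cNK : N \subset 'C(K).
  rewrite (sameP commG1P trivgP) -KN1 subsetI commg_subr commg_subl.
  by rewrite (subset_trans (normal_sub nsNR)) ?(subset_trans (normal_sub nsKR)) ?normal_norm.
have defKN : K <*> N = K * N by rewrite cent_joinEr.
have sKNR : K <*> N \subset R by rewrite join_subG !normal_sub.
have KN : K * N = R.
  rewrite -defKN; have [KNK|//] := overK (joing_subl K N) sKNR.
  case/negP: ntN; rewrite -subG1 -KN1 subsetI subxx andbT -KNK joing_subr //.
have abN : abelian N.
  rewrite cyclic_abelian // prime_cyclic //.
  have := TI_cardMg KN1; rewrite KN oR oK => /eqP.
  by rewrite eqn_pmul2l ?prime_gt0 // => /eqP <-.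
by rewrite -KN abelianM abK abN.
Qed.

Lemma Frobenius_case :
  has_symmetry R S \/ (gcore R G = 1 /\ almost_simple G).
Proof.
have [nsRG|nsRG] := boolP (R <| G); first by left; apply: normal_symmetry.
have solR : solvable R.
  rewrite (series_sol nsKR) abelian_sol //=.
  by rewrite abelian_sol // cyclic_abelian // prime_cyclic // card_quotient ?normal_norm.
have sqf p : logn p #|R| <= 1.
  rewrite oR lognM ?prime_gt0 // !logn_prime //; case: eqP => [->|_]; case: eqP => // rq.
  by case/eqP: neqr.
have nsNG := gcore_normal sRG; have sNR := gcore_sub R G.
have neNR : gcore R G != R.
  by apply: contra nsRG => /eqP defN; rewrite -{1}defN.
have Ncases := normal_cases (normalS sNR sRG nsNG) neNR.
have core_cases := maximal_core_cases solR maxR nsRG sqf.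
have cycN : cyclic (gcore R G).
  by case: Ncases => ->; rewrite ?cyclic1 // prime_cyclic ?oK.
case: core_cases => [[nabRN simG]|[p [M soc]]].
  case: Ncases => /= defN; rewrite defN in nabRN simG.
    by right; split; last exact: almost_simple_quotient1.
  case/negP: nabRN; rewrite cyclic_abelian // prime_cyclic //.
  by rewrite card_quotient ?normal_norm.
have p_pr := asoc_pr soc; left.
case: (socle_compl_or_cofactor tiRL defG coreL nsRG sqf nsNG cycN soc).
  case=> E [[nsEG abE pE tiER defG'] [neLE pR p'N sEM]].
  (* [R / N] has no nontrivial normal [p]-subgroup: this excludes [N = 1] with [p = q], and [N = K]
     with [p = r]. *)
  have [N1 pr] : gcore R G = 1 /\ p = r.
    have pqr : p = q \/ p = r.
      move: pR; rewrite oR Euclid_dvdM // !dvdn_prime2 //.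
      by case/orP=> /eqP; [left | right].
    case: Ncases => defN; case: pqr => // pqr.
    - have KN : K :=: gcore R G.
        apply: (asoc_pcore soc) => //; first by rewrite /= defN sub1G.
        by rewrite quotient_pgroup // /pgroup oK pqr pnat_id.
      by move: q_pr; rewrite -oK KN /= defN cards1.
    - by move: p'N; rewrite /= defN oK pqr dvdnn.
    case/eqP: neNR; apply: esym; apply: (asoc_pcore soc) => //.
    by rewrite /pgroup /= defN card_quotient ?normal_norm // -divgS ?normal_sub // oR oK mulKn ?prime_gt0 // pqr pnat_id.
  have [oX oEH defP _] := compl_structure tiRL defG p_pr nsEG pE tiER defG' neLE (sqf p).
  pose X := ((E <*> L) :&: R)%G; pose H0 := (E :&: L)%G.
  have sXR : X \subset R := subsetIr _ _.
  have maxX : maximal X R.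
    rewrite p_index_maximal // -divgS // oR oX pr mulnK ?prime_gt0 //.
  have nHX : X \subset 'N_R(H0).
    by rewrite subsetI sXR (subset_trans (subsetIl _ _)) ?compl_norm.
  apply: (compl_symmetry p_pr nsEG abE pE tiER defG' neLE (sqf p)).
    move=> y x Sy Hy Xx; have Ry := subsetP sSR y Sy.
    have Ny : y \in 'N_R(H0) by rewrite inE Ry inE Hy subxx.
    (* [X] is maximal in [R], so the normaliser of [H0] in [R] is [X], abelian and containing both
       [x] and [y], or all of [R]. In the latter case irreducibility gives [H0 = 1]. *)
    have [WX|WR] := maximal_over maxX nHX (subsetIl _ _).
      have abX : abelian X by rewrite cyclic_abelian // prime_cyclic ?oX.
      rewrite WX in Ny.
      by rewrite conjgE (centsP abX y Ny x Xx) mulKg.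
    have nHR : R \subset 'N(H0) by rewrite -WR subsetIr.
    have [H1|HE] := compl_irr nsEG tiER (subsetIl _ _) maxR nHR; last first.
      by move: oEH; rewrite HE indexgg => p1; rewrite -p1 in p_pr.
    (* Now [E] has order [p], so the derived subgroup of [G] centralises it, while ['C_R(E)] lies in
       the trivial core: [R] would be abelian. *)
    case/negP: nabR; apply/derG1P/trivgP; rewrite -N1.
    have cE : 'C_R(E) \subset gcore R G.
      rewrite gcore_max ?subsetIl // -defG' mul_subG //.
        by rewrite cents_norm // centsC subsetIr.
      by rewrite normsI ?normG ?norms_cent // (subset_trans sRG) ?normal_norm.
    apply: subset_trans cE; rewrite subsetI der_sub.
    apply: subset_trans (dergS 1 sRG) _; apply: der1_sub_cent_cyclic (normal_norm nsEG).
    by rewrite prime_cyclic // -[#|E|]mul1n -(indexg1 E) -H1 oEH mul1n.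
  apply/negP=> cX.
  have nsXR : X <| R by rewrite /normal sXR cents_norm // centsC.
  have neXR : X :!=: R by have := maxgroupp maxX; apply: proper_neq.
  have [X1|XK] := normal_cases nsXR neXR.
    by move: p_pr; rewrite -oX X1 cards1.
  by case/eqP: neqr; rewrite -oK -XK oX.
case=> E [N0 [[nsEG abE sN0N oN0] [defE tiN0L pE sEM]]].
have defN0 : N0 :=: K.
  have NK : gcore R G = K.
    case: Ncases => // N1; move: p_pr; rewrite -oN0.
    by rewrite (_ : N0 :=: 1) ?cards1 //; apply/trivgP; rewrite -N1.
  have sN0K : N0 \subset K by rewrite -NK.
  apply/eqP; rewrite eqEcard sN0K oK oN0 /=.
  by have := cardSg sN0K; rewrite oN0 oK dvdn_prime2 // => /eqP->.
have sN0R : N0 \subset R by rewrite defN0 normal_sub.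
have fus := cofactor_fusion p_pr nsEG abE sN0R oN0 defE tiN0L.
have [k Kk nck] := subsetPn ncKR.
apply: (symmetry_conj sSR (subsetP (normG R) _ (subsetP (normal_sub nsKR) _ Kk)) nck) => y Sy.
have Ry := subsetP sSR y Sy.
have sKE : K \subset E by rewrite -defN0 -defE mulG_subl.
have sLE : L \subset E by rewrite -defE mulG_subr.
have [Ny|nNy] := boolP (y \in 'N(L)).
  (* [K] lies in the abelian group [E], so it normalises [L]; by maximality [K] is all of ['N_R(L)],
     and [k] commutes with [y]. *)
  have sKN : K \subset 'N_R(L).
    rewrite subsetI normal_sub //= cents_norm //.
    by rewrite (subset_trans sKE) // (subset_trans abE) // centS.
  have [WK|WR] := overK sKN (subsetIl _ _); last first.
    by case/negP: maximal_not_norm_compl; rewrite -WR subsetIr.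
  have Ky : y \in K by rewrite -WK inE Ry.
  by rewrite conjgE (centsP abK y Ky k Kk) mulKg.
have -> : y ^ k = k^-1 * k ^ y^-1 * y by rewrite !conjgE invgK !mulgA mulgKV.
apply: fus => //; rewrite defN0 groupM ?groupV //.
by rewrite memJ_norm // groupV (subsetP (normal_norm nsKR)).
Qed.

End Frobenius.
End Symmetry.

(** * The case C_q x D_2r *)

Section DihedralCase.
Variable aT : finGroupType.
Implicit Types (A E N M X : {group aT}).

Variables (G R L : {group aT}) (S : {set aT}).
Hypotheses (tiRL : R :&: L = 1) (defG : R * L = G).
Hypotheses (coreL : forall A, A <| G -> A \subset L -> A :=: 1).
Hypotheses (maxR : maximal R G) (sSR : S \subset R).
Hypothesis SL : forall x l1 l2,
  x \in S -> l1 \in L -> l2 \in L -> l1 * x * l2 \in R -> l1 * x * l2 \in S.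

Variables (q r : nat) (Q D Z : {group aT}).
Hypotheses (dihDZ : dihedral_pair r D Z) (r35 : (r == 3) || (r == 5)).
Hypotheses (q_pr : prime q) (oddq : odd q) (neqr : q != r).
Hypotheses (defR : Q \x D = R) (oQ : #|Q| = q).
Hypotheses (SV : forall x, x \in S -> x^-1 \in S).

Let sLG : L \subset G. Proof. by rewrite -defG mulG_subr. Qed.
Let sRG : R \subset G. Proof. by rewrite -defG mulG_subl. Qed.
Let r_pr := dih_pr dihDZ.
Let oddr := dih_odd dihDZ.
Let sZD := dih_sub dihDZ.
Let oZ := dih_cardZ dihDZ.
Let nsQR : Q <| R. Proof. by have [] := dprod_normal2 defR. Qed.
Let nsDR : D <| R. Proof. by have [] := dprod_normal2 defR. Qed.
Let sQR := normal_sub nsQR.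
Let sDR := normal_sub nsDR.
Let defQD : Q * D = R. Proof. by have [] := dprodP defR. Qed.
Let cQD : D \subset 'C(Q). Proof. by have [] := dprodP defR. Qed.
Let tiQD : Q :&: D = 1. Proof. by have [] := dprodP defR. Qed.
Let abQ : abelian Q. Proof. by rewrite cyclic_abelian // prime_cyclic ?oQ. Qed.
Let abZ : abelian Z. Proof. by rewrite cyclic_abelian // prime_cyclic ?oZ. Qed.
Let nsZD : Z <| D. Proof. exact: index2_normal sZD (dihedral_index dihDZ). Qed.
Let nsZR : Z <| R.
Proof.
rewrite /normal (subset_trans sZD) // -defQD mul_subG //; last exact: normal_norm.
by rewrite cents_norm // centsC (subset_trans sZD).
Qed.
Let oR : #|R| = (q * (2 * r))%N.
Proof. by rewrite -(dprod_card defR) oQ (dih_card dihDZ). Qed.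
Let neq2 : q != 2. Proof. by apply: contraTneq oddq => ->. Qed.
Let ner2 : r != 2. Proof. by apply: contraTneq oddr => ->. Qed.

Let sqf p : logn p #|R| <= 1.
Proof.
rewrite oR !lognM ?muln_gt0 ?prime_gt0 // !logn_prime //.
case: eqP => [->|_]; first by rewrite (negPf neq2) (negPf neqr).
by case: eqP => [->|_]; [rewrite eq_sym (negPf ner2) | case: eqP].
Qed.

Let dvdR p : prime p -> p %| #|R| -> [\/ p = q, p = 2 | p = r].
Proof.
move=> p_pr; rewrite oR !Euclid_dvdM // !dvdn_prime2 //.
by case/or3P=> /eqP; [constructor 1 | constructor 2 | constructor 3].
Qed.

Let solR : solvable R.
Proof.
rewrite (series_sol nsQR) abelian_sol //= -defQD quotientMidl quotient_sol //.
rewrite (series_sol nsZD) abelian_sol //=.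
by rewrite abelian_sol // cyclic_abelian // prime_cyclic // card_quotient ?normal_norm //
   (dihedral_index dihDZ).
Qed.

Let der1R : R^`(1) \subset Z.
Proof.
rewrite der1_min ?normal_norm // -defQD quotientMl; last first.
  by rewrite (subset_trans sQR) ?normal_norm.
rewrite abelianM quotient_abelian //= quotient_cents // andbT.
by rewrite cyclic_abelian // prime_cyclic // card_quotient ?normal_norm // (dihedral_index dihDZ).
Qed.

Let centD x : x \in D -> x \in 'C(D) -> x = 1.
Proof.
move=> Dx cx; apply/eqP; apply: contraT => ntx.
have oddZ : odd #|Z| by rewrite oZ.
have cxZ z : z \in Z -> z ^ x = z.
  by move=> Zz; rewrite conjgE -(centP cx z (subsetP sZD z Zz)) mulKg.
have [Zx|Zx] := boolP (x \in Z).
  have [t Dt Zt] := dihedral_exists dihDZ.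
  have := odd_invg_neq oddZ Zx ntx; rewrite -(dih_inv dihDZ Dt Zt Zx).
  by rewrite conjgE (centP cx t Dt) mulKg eqxx.
have ntZ : Z :!=: 1 by rewrite -cardG_gt1 oZ prime_gt1.
have [z Zz ntz] := trivgPn _ ntZ.
have := odd_invg_neq oddZ Zz ntz.
by rewrite -(dih_inv dihDZ Dx Zx Zz) cxZ ?eqxx.
Qed.

Let coQD : coprime #|Q| #|D|.
Proof.
rewrite oQ (dih_card dihDZ) prime_coprime // Euclid_dvdM // !dvdn_prime2 //.
by rewrite negb_or neq2 neqr.
Qed.

Let subD X : q^'.-group X -> X \subset R -> X \subset D.
Proof.
move=> q'X sXR; have hallD : q^'.-Hall(R) D.
  rewrite /pHall sDR -divgS // oR (dih_card dihDZ) mulnK ?muln_gt0 ?prime_gt0 //.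
  rewrite pnatNK pnat_id // andbT /pgroup (dih_card dihDZ) p'natE //.
  by rewrite Euclid_dvdM // !dvdn_prime2 // negb_or neq2 neqr.
by rewrite (sub_normal_Hall hallD).
Qed.

Let normal_cases N : N <| R -> N :!=: R ->
  (N :=: 1 \/ N :=: Q) \/ [\/ N :=: Z, N :=: Q * Z | N :=: D].
Proof.
move=> /andP[sNR nNR] neNR.
have defN : N :=: (N :&: Q) * (N :&: D).
  apply/eqP; rewrite eqEsubset mul_subG ?subsetIl // andbT.
  apply/subsetP=> x Nx; have := subsetP sNR x Nx; rewrite -defQD => /mulsgP[a b Qa Db def_x].
  have Na : a \in N.
    (* [x ^+ #|D|] equals [a ^+ #|D|], and [#|D|] is prime to [#|Q|], so a further power recovers
       [a]. *)
    have cab : commute a b by apply/esym/(centsP cQD).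
    have : x ^+ #|D| \in N by rewrite groupX.
    rewrite def_x expgMn // (expg_cardG Db) mulg1 => NaD.
    by rewrite -(expgK coQD Qa) groupX.
  by rewrite def_x mem_mulg // inE ?Na ?Qa // Db andbT -(groupMl b Na) -def_x.
have QN : N :&: Q = 1 \/ N :&: Q = Q.
  have [sQN|nsQN] := boolP (Q \subset N); first by right; apply/setIidPr.
  by left; rewrite setIC prime_TIg ?oQ.
have DN : [\/ N :&: D = 1, N :&: D = Z | (N :&: D = D)].
  have [sZN|nsZN] := boolP (Z \subset N).
    have prDZ : prime #|D : Z| by rewrite (dihedral_index dihDZ).
    have sZND : Z \subset N :&: D by rewrite subsetI sZN.
    by case: (maximal_over (p_index_maximal sZD prDZ) sZND (subsetIr _ _)) => ->;
      [constructor 2 | constructor 3].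
  have NZ1 : N :&: Z = 1 by rewrite setIC prime_TIg ?oZ.
  constructor 1; apply/trivgP/subsetP=> x /setIP[Nx Dx]; apply/set1P.
  have ZR := subset_trans sZD sDR.
  have cNZ : N \subset 'C(Z).
    rewrite (sameP commG1P trivgP) -NZ1 subsetI commg_subr commg_subl.
    by rewrite (subset_trans ZR) // (subset_trans sNR) // normal_norm.
  have [Zx|Zx] := boolP (x \in Z); first by apply/set1gP; rewrite -NZ1 inE Nx.
  have ntZ : Z :!=: 1 by rewrite -cardG_gt1 oZ prime_gt1.
  have [z Zz ntz] := trivgPn _ ntZ.
  have oddZ : odd #|Z| by rewrite oZ.
  have := odd_invg_neq oddZ Zz ntz; rewrite -(dih_inv dihDZ Dx Zx Zz).
  by rewrite conjgE -(centsP cNZ x Nx z Zz) mulKg eqxx.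
move: defN; case: QN => ->; case: DN => ->; rewrite ?mul1g ?mulg1 ?defQD => defN.
- by left; left.
- by right; constructor 1.
- by right; constructor 3.
- by left; right.
- by right; constructor 2.
by rewrite defN eqxx in neNR.
Qed.

Let oddZ : odd #|Z|. Proof. by rewrite oZ. Qed.
Let nRL := maximal_not_norm_compl defG coreL maxR.

Let not_cent_R p X : #|X| = p -> prime p -> p != q -> X \subset R -> ~~ (X \subset 'C(R)).
Proof.
move=> oX p_pr nepq sXR; apply/negP=> cXR.
have sXD : X \subset D.
  by apply: subD => //; rewrite /pgroup oX p'natE // dvdn_prime2 // eq_sym.
have ntX : X :!=: 1 by rewrite -cardG_gt1 oX prime_gt1.
have [x Xx /eqP[]] := trivgPn _ ntX; apply: centD; first exact: (subsetP sXD).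
by apply: (subsetP (centS sDR)); apply: (subsetP cXR).
Qed.

(** Suppose [y] normalises [H = E :&: L] without commuting with [x]. Then [[~ x, y]] generates [Z],
    which normalises [H]. The proper subgroup [H] contains [[~: E, Z]], trivial by irreducibility,
    so [Z] is normal in [E R = G], against the assumption. *)
Lemma compl_2_symmetry E :
  ~~ (Z \subset gcore R G) -> E <| G -> abelian E -> 2.-group E -> E :&: R = 1 ->
  E * R = G -> L :!=: E -> has_symmetry R S.
Proof.
move=> nZN nsEG abE pE tiER defG' neLE.
have [oX oEH _ _] := compl_structure tiRL defG (isT : prime 2) nsEG pE tiER defG' neLE (sqf 2).
have sXR : (E <*> L) :&: R \subset R := subsetIr _ _.
apply: (compl_symmetry tiRL defG sSR SL _ nsEG abE pE tiER defG' neLE (sqf 2)) => //; last first.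
  by apply: (not_cent_R oX) => //; rewrite eq_sym.
move=> y x Sy Hy Xx; have Ry := subsetP sSR y Sy; have Rx := subsetP sXR x Xx.
have [cxy|ncxy] := eqVneq [~ x, y] 1.
  have cxy' : commute x y by apply/commgP/eqP.
  by rewrite conjgE -cxy' mulKg.
case/negP: nZN; set H := E :&: L.
have nHx : x \in 'N(H) by apply: (subsetP (compl_norm defG nsEG abE)); case/setIP: Xx.
have nHy : y \in 'N(H) by rewrite inE Hy.
have Zxy : [~ x, y] \in Z by apply: (subsetP der1R); rewrite mem_commg.
have nHZ : Z \subset 'N(H).
  have -> : Z = <[[~ x, y]]> :> {set aT}.
    apply/eqP; rewrite eq_sym eqEcard cycle_subG Zxy /= -/(order _).
    have := order_dvdG Zxy; rewrite oZ.
    case/primeP: r_pr => _ pr /pr/pred2P[o1|->//].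
    by rewrite -order_eq1 o1 in ncxy.
  by rewrite cycle_subG groupR.
have sHE : H \subset E := subsetIl _ _.
have nER := subset_trans sRG (normal_norm nsEG).
have nEZ : Z \subset 'N(E) := subset_trans (normal_sub nsZR) nER.
(* [H] has index 2 in [E], so [Z] preserves both cosets. *)
have sEZH : [~: E, Z] \subset H.
  rewrite gen_subG; apply/subsetP=> _ /imset2P[e z Ee Zz ->]; rewrite commgEl.
  have nHz := subsetP nHZ z Zz.
  have [He|He] := boolP (e \in H); first by rewrite groupM ?groupV ?memJ_norm.
  have Eez : e ^ z \in E by rewrite memJ_norm // (subsetP nEZ).
  have : e ^ z \in H :* e.
    have Hez : e ^ z \notin H by rewrite memJ_norm.
    by rewrite (rcoset_index2 sHE oEH) inE ?He ?Hez.
  case/rcosetP=> h Hh ->.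
  by rewrite (centsP abE h (subsetP sHE h Hh) e Ee) mulKg.
have nEZR : R \subset 'N([~: E, Z]) by rewrite normsR // normal_norm.
have sEZE : [~: E, Z] \subset E by rewrite commg_subl.
have [EZ1|EZE] := compl_irr nsEG tiER sEZE maxR nEZR; last first.
  have HE : H = E by apply/eqP; rewrite eqEsubset sHE -{1}EZE.
  by move: oEH; rewrite /= -/H HE indexgg.
rewrite gcore_max ?(normal_sub nsZR) // -defG' mul_subG //; last exact: normal_norm.
by rewrite cents_norm // (sameP commG1P eqP) EZ1.
Qed.

(** [N0] is [Q] or [Z], and the matching fusion lemma applies. For [N0 = Z] all of [D] normalises
    [L], since reflections invert [E]; a further element of ['N_R(L)] would make [Q] normalise [L]
    too. *)
Lemma cyclic_core_symmetry p M E N0 :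
  abelian_socle p (gcore R G) M R G -> M \subset 'C(gcore R G) ->
  gcore R G \subset Q * Z -> E <| G -> abelian E -> N0 \subset gcore R G ->
  #|N0| = p -> N0 * L = E -> N0 :&: L = 1 -> p.-group E -> E \subset M ->
  has_symmetry R S.
Proof.
move=> soc cMN sNQZ nsEG abE sN0N oN0 defE tiN0L pE sEM.
have p_pr := asoc_pr soc; set N := gcore R G in soc cMN sNQZ sN0N.
have sNR : N \subset R by apply: gcore_sub.
have sN0R := subset_trans sN0N sNR.
have fus := cofactor_fusion defG sSR SL p_pr nsEG abE sN0R oN0 defE tiN0L.
have sN0E : N0 \subset E by rewrite -defE mulG_subl.
have sLE : L \subset E by rewrite -defE mulG_subr.
have N0nL : N0 \subset 'N(L) by rewrite cents_norm // (sub_abelian_cent2 abE).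
have oQZ : #|Q * Z| = (q * r)%N.
  by rewrite TI_cardMg ?oQ ?oZ //; apply/trivgP; rewrite -tiQD setIS.
have tQZ b : b \in D -> b \notin Z -> b \notin N.
  move=> Db Zb; apply/negP=> /(subsetP sNQZ)/mulsgP[a z Qa Zz def_b].
  case/negP: Zb; rewrite def_b groupMr //.
  have : a \in Q :&: D by rewrite inE Qa -(groupMr a (subsetP sZD z Zz)) -def_b.
  by rewrite tiQD => /set1gP->.
have prime_sub A : prime #|A| -> p %| #|A| -> A <| R -> N0 :=: A.
  move=> A_pr pA nsAR; have oA : #|A| = p by apply/eqP; rewrite eq_sym -dvdn_prime2.
  have hallA : p.-Sylow(R) A.
    rewrite pHallE (normal_sub nsAR) oA p_part /=; have := sqf p.
    have : 0 < logn p #|R| by rewrite logn_gt0 mem_primes p_pr cardG_gt0 -oA cardSg ?normal_sub.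
    by case: (logn p #|R|) => [|[|n]].
  apply/eqP; rewrite eqEcard oA oN0 leqnn andbT (sub_normal_Hall hallA) //.
  by rewrite /pgroup oN0 pnat_id.
have cZQ : Z \subset 'C(Q) := subset_trans sZD cQD.
have sNQZ' : N \subset Q <*> Z by rewrite cent_joinEr.
have pqr : p = q \/ p = r.
  have : p %| #|R| by rewrite -oN0 cardSg.
  case/(dvdR p_pr); [by left | move=> p2 | by right].
  have : p %| #|Q <*> Z|.
    by rewrite -oN0 cardSg // (subset_trans sN0N) // sNQZ'.
  rewrite cent_joinEr // oQZ Euclid_dvdM // !dvdn_prime2 //.
  by rewrite p2 ![2 == _]eq_sym (negPf neq2) (negPf ner2).
have [defN0|defN0] : N0 :=: Q \/ N0 :=: Z.
- by case: pqr => pqr; [left | right]; apply: prime_sub; rewrite ?oQ ?oZ ?pqr.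
- have ntQ : Q :!=: 1 by rewrite -cardG_gt1 oQ prime_gt1.
  have oddQ : odd #|Q| by rewrite oQ.
  rewrite defN0 in N0nL fus.
  exact: (symmetry_fusion_Q dihDZ r35 defR abQ oddQ ntQ sSR SV nRL N0nL fus).
have sZN : Z \subset N by rewrite -defN0.
have nsNG : N <| G := gcore_normal sRG; have nsMG := asoc_normal soc.
have ENZ : E :&: N \subset Z.
  have hallZ : r.-Sylow(R) Z.
    rewrite pHallE (normal_sub nsZR) oZ p_part /=; have := sqf r.
    have : 0 < logn r #|R| by rewrite logn_gt0 mem_primes r_pr cardG_gt0 -oZ cardSg ?normal_sub.
    by case: (logn r #|R|) => [|[|n]].
  rewrite (sub_normal_Hall hallZ) // ?(subset_trans (subsetIr _ _)) //.
  by apply: pgroupS (subsetIl _ _) _; rewrite -oZ -defN0 oN0.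
have invE t : t \in D -> t \notin Z -> t \in 'N(L).
  move=> Dt Zt; have Rt := subsetP sDR t Dt.
  have nMR := subset_trans sRG (normal_norm nsMG).
  have nNR := subset_trans sRG (normal_norm nsNG).
  have nER := subset_trans sRG (normal_norm nsEG).
  (* For [y] in [R], [t ^ y] lies in [t Z], and [Z] centralises [E], so [t] and [t ^ y] have the
     same centraliser in [E]. *)
  have nCR : R \subset 'N('C_E[t]).
    apply/normsP=> y Ry; rewrite conjIg (normsP nER y Ry) -cent1J.
    have [z Zz ->] : exists2 z, z \in Z & t ^ y = t * z.
      exists [~ t, y]; last by rewrite conjg_mulR.
      by rewrite (subsetP der1R) // mem_commg.
    have Ez : z \in E by rewrite (subsetP sN0E) // defN0.
    apply/setP=> x; rewrite !in_setI; case Ex: (x \in E) => //=.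
    have cxz := centsP abE x Ex z Ez.
    apply/cent1P/cent1P=> cxt; last exact: commuteM.
    by rewrite -(mulgK z t); apply: commuteM => //; apply: commuteV.
  have sCE : 'C_E[t] \subset E := subsetIl _ _.
  have C1 : 'C_E[t] = 1.
    have sA : N <*> 'C_E[t] \subset M by rewrite join_subG (asoc_sub soc) (subset_trans sCE).
    have nA : R \subset 'N(N <*> 'C_E[t]) by rewrite normsY.
    have [AN|AM] := asoc_irr soc (joing_subl _ _) sA nA.
      apply/trivgP/subsetP=> x Cx; have [Ex cxt] := setIP Cx.
      have Zx : x \in Z.
        have AN' : N <*> 'C_E[t] = N := AN.
        by rewrite (subsetP ENZ) // inE Ex -AN' mem_gen // inE Cx orbT.
      have := dih_inv dihDZ Dt Zt Zx; rewrite conjgE (cent1P cxt) mulKg => xV.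
      by apply/set1gP/eqP; apply: contraT => /(odd_invg_neq oddZ Zx); rewrite -xV eqxx.
    (* If [N] and ['C_E[t]] generate [M], then [M] normalises [A]; so does [R], as [A] contains its
       derived subgroup. Thus [A] lies in the core, which contains no reflection. *)
    pose A := (N <*> <[t]>)%G.
    have sAR : A \subset R by rewrite join_subG sNR cycle_subG.
    have nAR : R \subset 'N(A).
      rewrite normal_norm // sub_der1_normal // (subset_trans der1R) //.
      by rewrite (subset_trans sZN) ?joing_subl.
    have nAM : M \subset 'N(A).
      have AM' : N <*> 'C_E[t] = M := AM.
      rewrite -AM' join_subG; apply/andP; split.
        by rewrite (subset_trans _ (normG A)) ?joing_subl.
      have nCN : 'C_E[t] \subset 'N(N).
        apply: subset_trans sCE (subset_trans sEM _).
        exact: subset_trans (normal_sub nsMG) (normal_norm nsNG).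
      have nCt : 'C_E[t] \subset 'N(<[t]>) by rewrite cents_norm // cent_cycle subsetIr.
      exact: normsY.
    have sAN : A \subset N.
      by apply: gcore_max => //; rewrite -(asoc_mul soc) mul_subG.
    case/negP: (tQZ t Dt Zt); rewrite (subsetP sAN) // mem_gen // inE cycle_id orbT //.
  (* [x * x ^ t] is fixed by the involution [t] because [E] is abelian, so it is trivial. *)
  have invt x : x \in E -> x ^ t = x^-1.
    move=> Ex; have Ext : x ^ t \in E by rewrite memJ_norm // (subsetP nER).
    have t2 := dih_invol dihDZ Dt Zt.
    have : x * x ^ t \in 'C_E[t].
      rewrite inE groupM //; apply/cent1P/commgP/conjg_fixP.
      by rewrite conjMg -conjgM t2 conjg1 (centsP abE x Ex _ Ext).
    rewrite C1 => /set1gP xx; apply/eqP; rewrite eq_sym eq_invg_mul xx //.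
  rewrite inE; apply/subsetP=> _ /imsetP[l Ll ->].
  by rewrite invt ?groupV // (subsetP sLE).
have nDL : D \subset 'N(L).
  apply/subsetP=> b Db; have [Zb|Zb] := boolP (b \in Z); last exact: invE.
  by apply: (subsetP N0nL); rewrite defN0.
rewrite defN0 in fus.
apply: (symmetry_fusion_Z dihDZ r35 defR sSR SV _ fus).
move=> y; rewrite -{1}defQD => /mulsgP[a b Qa Db ->]; rewrite (groupMr a (subsetP nDL b Db)) => Na.
have [-> | nta] := eqVneq a 1; first by rewrite mul1g.
case/negP: nRL; rewrite -defQD mul_subG //.
have -> : Q = <[a]> :> {set aT}.
  apply/eqP; rewrite eq_sym eqEcard cycle_subG Qa /= -/(order a).
  have := order_dvdG Qa; rewrite oQ.
  case/primeP: q_pr => _ pr /pr/pred2P[o1|->//].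
  by rewrite -order_eq1 o1 in nta.
by rewrite cycle_subG.
Qed.

(* If the core is D then G = C_G(D) x D, and E = M :&: C_G(D) complements R. *)
Lemma dihedral_core_symmetry p M :
  ~~ (R <| G) -> gcore R G = D -> abelian_socle p (gcore R G) M R G -> has_symmetry R S.
Proof.
move=> nsRG defN soc; have p_pr := asoc_pr soc; have nsMG := asoc_normal soc.
have nsDG : D <| G by rewrite -defN gcore_normal.
have [sMG nMG] := andP nsMG; have [sDG nDG] := andP nsDG.
have sDM : D \subset M by rewrite -defN (asoc_sub soc).
have nDM := subset_trans sMG nDG.
have nepq : p != q.
  apply/negP=> /eqP pq; have := asoc_pcore soc (gcore_sub R G) (normal_refl R).
  rewrite /pgroup /= defN card_quotient ?normal_norm // -divgS // oR (dih_card dihDZ).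
  rewrite mulnK ?muln_gt0 ?prime_gt0 // pq pnat_id // => /(_ isT) RD.
  by case/negP: nsRG; rewrite RD.
pose C := 'C_G(D)%G.
have nsCG : C <| G by rewrite /normal subsetIl normsI ?normG ?norms_cent.
have tiCD : C :&: D = 1.
  apply/trivgP/subsetP=> x /setIP[/setIP[_ cx] Dx]; apply/set1gP; exact: centD.
have sQC : Q \subset C by rewrite subsetI (subset_trans sQR) // centsC.
have defCD : C * D = G.
  have sR : R \subset C <*> D.
    rewrite -defQD mul_subG ?joing_subr //.
    by rewrite (subset_trans sQC) ?joing_subl.
  have sG : C <*> D \subset G by rewrite join_subG subsetIl.
  have [CDR|CDG] := maximal_over maxR sR sG.
    by case/negP: nsRG; rewrite -CDR normalY.
  by rewrite -CDG /= norm_joinEl // (subset_trans (subsetIl _ _)).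
pose E := (M :&: C)%G.
have nsEG : E <| G by rewrite normalI.
have defM : E * D = M by rewrite /E /= group_modr // defCD; apply/setIidPl.
have tiED : E :&: D = 1 by apply/trivgP; rewrite -tiCD setSI // subsetIr.
have tiER : E :&: R = 1.
  apply/trivgP; rewrite -tiED subsetI subsetIl -defN -(asoc_meet soc) setSI // subsetIl //.
have sDR' : D * R = R by rewrite mulSGid.
have defG' : E * R = G by rewrite -sDR' mulgA defM (asoc_mul soc).
have abE : abelian E.
  apply/derG1P/trivgP; rewrite -tiED subsetI der_sub.
  rewrite (subset_trans (dergS 1 (subsetIl M C))) // der1_min //.
  by have := abelem_abelian (asoc_abelem soc); rewrite /= defN.
have pE : p.-group E.
  have := abelem_pgroup (asoc_abelem soc); rewrite /= defN /pgroup card_quotient //.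
  by rewrite -divgS // -{1}defM TI_cardMg // mulnK.
have neLE : L :!=: E.
  by apply: contra nRL => /eqP->; rewrite (subset_trans sRG) ?normal_norm.
have [oX oEH _ defP] := compl_structure tiRL defG p_pr nsEG pE tiER defG' neLE (sqf p).
have sXR : (E <*> L) :&: R \subset R := subsetIr _ _.
have cED : E \subset 'C(D) by rewrite subIset // orbC subsetIr.
apply: (compl_symmetry tiRL defG sSR SL p_pr nsEG abE pE tiER defG' neLE (sqf p)); last first.
  exact: (not_cent_R oX).
move=> y x Sy Hy Xx; have Ry := subsetP sSR y Sy; have Rx := subsetP sXR x Xx.
move: (Ry); rewrite -defQD => /mulsgP[a b Qa Db def_y].
(* If [y] is in [D], write [x = l e]: [e] centralises [D], so [y ^ x = y ^ l] is in [L y L].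
   Otherwise [a] normalises [H], because [b] centralises it; so [R] normalises [H], whence [H = 1]
   and [#|E| = p]. *)
have [a1 | nta] := eqVneq a 1.
  have : x \in (E <*> L)%G by case/setIP: Xx.
  rewrite defP => /mulsgP[l e Ll Ee def_x].
  have Dy : y \in D by rewrite def_y a1 mul1g.
  have -> : y ^ x = y ^ l.
    have Dyl : y ^ l \in D by rewrite memJ_norm // (subsetP nDG) // (subsetP sLG).
    have ce : commute e (y ^ l) := centsP cED e Ee _ Dyl.
    by rewrite def_x conjgM [LHS]conjgE -ce mulKg.
  rewrite conjgE mulgA SL ?groupV // -mulgA -conjgE.
  by rewrite (subsetP sDR) // memJ_norm // (subsetP nDG) // (subsetP sLG).
set H := (E :&: L)%G; have sHE : H \subset E := subsetIl _ _.
have cHD : D \subset 'C(H) by rewrite centsC (subset_trans sHE).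
have nHQ : Q \subset 'N(H).
  have -> : Q = <[a]> :> {set aT}.
    apply/eqP; rewrite eq_sym eqEcard cycle_subG Qa /= -/(order a).
    have := order_dvdG Qa; rewrite oQ.
    case/primeP: q_pr => _ pr /pr/pred2P[o1|->//].
    by rewrite -order_eq1 o1 in nta.
  have nHb : b \in 'N(H) by rewrite (subsetP (cents_norm cHD)).
  have nHy : y \in 'N(H) by rewrite inE Hy.
  by rewrite cycle_subG -(groupMr a nHb) -def_y.
have nHR : R \subset 'N(H) by rewrite -defQD mul_subG // cents_norm.
have [H1|HE] := compl_irr nsEG tiER sHE maxR nHR; last first.
  by move: oEH p_pr; rewrite -/H HE indexgg => <-.
have oE : #|E| = p by rewrite -oEH -/H H1 indexg1.
have nEQ : Q \subset 'N(E) by rewrite (subset_trans sQR) // (subset_trans sRG) ?normal_norm.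
(* [Aut E] has order [p - 1], where [p] is 2, 3 or 5, so the odd prime [q] does not divide it. With
   [D] also centralising [E], [R] would be normal in [E R = G]. *)
have cEQ : Q \subset 'C(E).
  rewrite -ker_conj_aut ker_trivg_morphim nEQ /=.
  have : #|conj_aut E @* Q| %| #|Aut E| by rewrite cardSg ?Aut_conj_aut.
  rewrite card_Aut_cyclic ?prime_cyclic ?oE // totient_prime // => d1.
  have d2 := dvdn_morphim (conj_aut E) Q; rewrite oQ in d2.
  rewrite subG1 trivg_card1 -dvdn1; move: d1 d2.
  case/primeP: (q_pr) => _ pr d1 /pr/pred2P[->//|oq].
  move: d1; rewrite oq.
  have : p %| #|R| by rewrite -oX cardSg.
  case/(dvdR p_pr) => pE'; first by rewrite pE' eqxx in nepq.
    by rewrite pE' dvdn1.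
  have q2 : (q %| 2) = false by rewrite dvdn_prime2 // (negPf neq2).
  rewrite pE'; case/orP: r35 => /eqP->; first by rewrite q2.
  by rewrite (_ : 5.-1 = 2 * 2)%N // Euclid_dvdM // q2.
case/negP: nsRG; rewrite /normal sRG -defG' mul_subG ?normG //.
rewrite cents_norm // centsC -defQD mul_subG //.
by rewrite centsC.
Qed.

Lemma dihedral_case :
  has_symmetry R S \/ (gcore R G = 1 /\ almost_simple G)
  \/ (gcore R G = Q /\ almost_simple (G / Q)).
Proof.
have [nsRG|nsRG] := boolP (R <| G); first by left; apply: (normal_symmetry defG coreL maxR sSR SL).
have nsNG := gcore_normal sRG; have sNR := gcore_sub R G.
have nsNR : gcore R G <| R := normalS sNR sRG nsNG.
have neNR : gcore R G != R.
  by apply: contra nsRG => /eqP defN; rewrite -{1}defN.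
have Ncases := normal_cases nsNR neNR.
have abRN : Z \subset gcore R G -> abelian (R / gcore R G).
  by move=> sZN; rewrite sub_der1_abelian // (subset_trans der1R).
have cycQ : cyclic Q by rewrite prime_cyclic ?oQ.
have cycZ : cyclic Z by rewrite prime_cyclic ?oZ.
case: (maximal_core_cases solR maxR nsRG sqf) => [[nabRN simG]|[p [M soc]]].
  (* A core containing [Z] has abelian quotient [R / N], so only the cores [1] and [Q] remain. *)
  have nZN := contra abRN nabRN; right.
  case: Ncases => [[]|[]] /= defN; rewrite defN in simG nZN *.
  - by left; split; last exact: almost_simple_quotient1.
  - by right.
  - by rewrite subxx in nZN.
  - by rewrite mulG_subr in nZN.
  by rewrite sZD in nZN.
left; have p_pr := asoc_pr soc.
have [defN|neND] := eqVneq (gcore R G) D; first exact: (dihedral_core_symmetry nsRG defN soc).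
have sNQZ : gcore R G \subset Q * Z.
  case: Ncases => [[]|[]] /= defN; rewrite defN ?mulG_subl ?mulG_subr //.
    by rewrite (subset_trans (sub1G Q)) ?mulG_subl.
  by case/eqP: neND.
have cycN : cyclic (gcore R G).
  have cycQZ : cyclic (Q <*> Z).
    have cQZ : Z \subset 'C(Q) := subset_trans sZD cQD.
    rewrite cent_joinEr // cyclicM // oQ oZ prime_coprime // dvdn_prime2 //.
  by apply: cyclicS cycQZ; rewrite /= cent_joinEr // (subset_trans sZD).
case: (socle_compl_or_cofactor tiRL defG coreL nsRG sqf nsNG cycN soc).
  case=> E [[nsEG abE pE tiER defG'] [neLE pR p'N sEM]].
  (* A normal [p]-subgroup of [R] has trivial image in [R / N], so it lies in [N], whose order is
     prime to [p]. This excludes [p = q] and [p = r]. *)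
  have notin A : A <| R -> p %| #|A| -> ~ p.-group A.
    move=> nsAR pA pgA.
    have nNA : A \subset 'N(gcore R G) := subset_trans (normal_sub nsAR) (normal_norm nsNR).
    have := asoc_pcore soc (joing_subl _ A); rewrite normalY //= quotientYidl //.
    rewrite quotient_pgroup // => /(_ isT isT) AN.
    case/negP: p'N; apply: dvdn_trans pA _; rewrite /= -AN.
    by rewrite cardSg // joing_subr.
  case: (dvdR p_pr pR) => pqr.
  - by case: (notin Q) => //; rewrite ?oQ ?pqr // /pgroup oQ pnat_id.
  - rewrite pqr in pE; apply: (compl_2_symmetry _ nsEG abE pE) => //.
    (* If [Z] is in the core [N], then [N] and a reflection [t] generate a normal subgroup of [R]
       that is a 2-group modulo [N]. So [t] is in [N], which has odd order. *)
    apply/negP=> sZN.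
    have [t Dt Zt] := dihedral_exists dihDZ.
    have nsA : gcore R G <*> <[t]> <| R.
      rewrite sub_der1_normal ?(subset_trans der1R) ?(subset_trans sZN) ?joing_subl //.
      by rewrite join_subG sNR cycle_subG (subsetP sDR).
    have ot : #[t] = 2.
      have : #[t] %| 2 by rewrite order_dvdn expg2 (dih_invol dihDZ).
      have := primeP (isT : prime 2) => -[_ pr] /pr/pred2P[]// /eqP.
      by rewrite order_eq1 => /eqP t1; rewrite t1 group1 in Zt.
    have nNt : <[t]> \subset 'N(gcore R G).
      by rewrite cycle_subG (subsetP (normal_norm nsNR)) // (subsetP sDR).
    have := asoc_pcore soc (joing_subl _ <[t]>%G) nsA; rewrite /= quotientYidl //.
    rewrite quotient_pgroup; last by rewrite /pgroup -/(order t) ot pqr.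
    move=> /(_ isT) AN; case/negP: p'N; rewrite /= -AN pqr -ot.
    by rewrite cardSg ?joing_subr.
  by case: (notin Z) => //; rewrite ?oZ ?pqr // /pgroup oZ pnat_id.
case=> E [N0 [[nsEG abE sN0N oN0] [defE tiN0L pE sEM]]].
have cMN := socle_sub_cent nsRG nsNG cycN soc.
exact: (cyclic_core_symmetry soc cMN sNQZ nsEG abE sN0N oN0 defE tiN0L pE sEM).
Qed.

End DihedralCase.

(** * Cayley digraphs *)

Section Cayley.
Variables (gT : finGroupType) (S : {set gT}) (G : {group {perm gT}}).
Hypotheses (ltRG : rreg gT \proper G) (sGS : G \subset AutCay S).

Local Notation rho := (actperm_morphism (mulgr_action gT)).
Local Notation R := (rho @* [set: gT])%G.
Local Notation L := ('C_G[1 | 'P])%G.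

Lemma rhoE (x y : gT) : rho x y = y * x.
Proof. by rewrite /= actpermE. Qed.

Lemma injm_rho : 'injm rho.
Proof.
apply/injmP=> x y _ _ /permP/(_ 1).
by rewrite !rhoE !mul1g.
Qed.

Lemma mem_rho (x : gT) (A : {set gT}) : x \in A -> rho x \in rho @* A.
Proof. by move=> Ax; apply: mem_morphim; rewrite ?inE. Qed.

Lemma stab1E (l : {perm gT}) : l \in L -> l \in G /\ l 1 = 1.
Proof. by case/setIP=> Gl /astab1P. Qed.

Lemma rreg_TI : R :&: L = 1.
Proof.
apply/trivgP/subsetP=> p /setIP[/morphimP[x _ _ ->] /stab1E[_]].
by rewrite rhoE mul1g => ->; rewrite morph1 group1.
Qed.

Lemma rreg_mul : R * L = G.
Proof.
have sRG := proper_sub ltRG.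
apply/eqP; rewrite eqEsubset mul_subG ?subsetIl //=.
(* [rho x] sends [1] to [g^-1 1], which [g] sends back to [1]; so [rho x * g] is in the
   stabiliser. *)
apply/subsetP=> g Gg; pose x := g^-1 1.
have Rx : rho x \in R by apply: mem_rho; rewrite inE.
apply/mulsgP; exists (rho x)^-1 (rho x * g); rewrite ?groupV ?mulKg //.
apply/setIP; split; first by rewrite groupM // (subsetP sRG).
apply/astab1P.
by rewrite /= apermE permM rhoE mul1g permKV.
Qed.

(** A normal subgroup fixing [1] fixes its whole orbit under the regular group, that is, every
    point. *)
Lemma stab1_corefree (A : {group {perm gT}}) : A <| G -> A \subset L -> A :=: 1.
Proof.
move=> /andP[sAG nAG] sAL; apply/trivgP/subsetP=> a Aa; apply/set1gP/permP=> y.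
have Ry : rho y \in G.
  by apply: (subsetP (proper_sub ltRG)); apply: mem_rho; rewrite inE.
have : a ^ (rho y)^-1 \in L by rewrite (subsetP sAL) // memJ_norm // groupV (subsetP nAG).
case/stab1E=> _; rewrite conjgE invgK !permM rhoE mul1g perm1 => e.
by rewrite -[LHS](permKV (rho y)) e rhoE mul1g.
Qed.

(** An element of [R] is determined by the image of [1], here [l2 s] when [x = rho s]. This lies in
    [S], the set of out-neighbours of [1], because [l2] is a digraph automorphism fixing [1]. *)
Lemma stab1_double_coset (x l1 l2 : {perm gT}) :
  x \in rho @* S -> l1 \in L -> l2 \in L -> l1 * x * l2 \in R -> l1 * x * l2 \in rho @* S.
Proof.
case/morphimP=> s _ Ss -> /stab1E[_ l1E] /stab1E[Gl2 l2E] /morphimP[z _ _ def_z].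
rewrite def_z mem_rho //; have := congr1 (fun p : {perm gT} => p 1) def_z.
rewrite /= -[actperm _ z]/(rho z) !permM l1E -[actperm _ s]/(rho s) !rhoE !mul1g => <-.
have := subsetP sGS l2 Gl2; rewrite inE => /forallP/(_ 1)/forallP/(_ s)/eqP.
by rewrite l2E invg1 !mulg1 Ss => <-.
Qed.

(** The automorphism is pulled back along the isomorphism [rho]; a trivial pullback [b] would force
    [a = 1]. *)
Lemma symmetry_AutS : has_symmetry R (rho @* S) -> AutS S != 1.
Proof.
case=> a [AutRa nta aS].
have injV := injm_invm injm_rho.
pose b := Aut_isom injV (subxx _) a.
have bE x : b x = invm injm_rho (a (rho x)).
  have Rx : rho x \in R by apply: mem_rho; rewrite inE.
  by rewrite -(Aut_isomE injV (subxx _) AutRa Rx) /= invmE ?inE.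
have aR x : a (rho x) \in R.
  by rewrite Aut_closed // mem_rho ?inE.
have rb x : rho (b x) = a (rho x) by rewrite bE; apply: invmK; apply: aR.
have Sb : b @: S = S.
  apply/eqP; rewrite eqEcard card_imset ?leqnn ?andbT; last exact: perm_inj.
  apply/subsetP=> _ /imsetP[s Ss ->].
  have : a (rho s) \in rho @* S by rewrite -aS imset_f // mem_rho.
  by rewrite -rb => /morphimP[s' _ Ss' /(injmP injm_rho) ->]; rewrite ?inE.
have Autb : b \in Aut [set: gT].
  by have := Aut_Aut_isom injV (subxx _) a; rewrite /= morphim_invm ?subsetT.
apply: contraNneq nta => AutS1.
have b1 : b = 1 by apply/set1gP; rewrite -AutS1 inE Autb Sb eqxx.
apply/eqP; apply: (eq_Aut AutRa (group1 _)) => _ /morphimP[x _ _ ->].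
by rewrite -/(rho x) -rb b1 !perm1.
Qed.

End Cayley.

Theorem theorem4p12 (gT : finGroupType) (q r : nat) (S : {set gT})
    (G : {group {perm gT}}) :
  prime q -> prime r -> q != r ->
  ( ( (r == 3) || (r == 5) ) /\ odd q /\
      (exists K D : {group gT}, is_Cq_x_D2r K D q r) /\ S^-1 = S
    \/
    ( ~~ abelian [set: gT] /\
      exists K H : {group gT},
        [/\ K ><| H = [set: gT], cyclic K, #|K| = q, cyclic H & #|H| = r] ) ) ->
  rreg gT \proper G ->
  G \subset AutCay S ->
  maximal (rreg gT) G ->
  (AutS S != 1)
  \/ (gcore (rreg gT) G = 1 /\ almost_simple G)
  \/ (exists K D : {group gT}, is_Cq_x_D2r K D q r /\
        gcore (rreg gT) G = rreg_of K /\ almost_simple (G / rreg_of K)).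
Proof.
move=> q_pr r_pr neqr cases ltRG sGS maxR.
pose rho := actperm_morphism (mulgr_action gT).
have inj := injm_rho gT; have tiRL := rreg_TI G; have defG := rreg_mul ltRG.
have coreL := stab1_corefree ltRG.
have SL := stab1_double_coset sGS.
have sSR : rho @* S \subset rho @* [set: gT] by rewrite morphimS ?subsetT.
case: cases => [[r35 [oddq [[K [D dprodKD]] SV]]]|[nab [K [H [defKH cycK oK cycH oH]]]]].
  have [defKD cycK oK isoD] := dprodKD.
  have oddr : odd r by case/orP: r35 => /eqP->.
  have isoD' : rho @* D \isog 'D_(2 * r).
    by apply: isog_trans isoD; rewrite isog_sym sub_isog ?subsetT.
  have [Z dihDZ] := isog_dihedral_pair r_pr oddr isoD'.
  have defR : rho @* K \x rho @* D = rho @* [set: gT] by apply: injm_dprod; rewrite ?subsetT.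
  have oQ : #|rho @* K| = q by rewrite card_injm ?subsetT.
  have SV' x : x \in rho @* S -> x^-1 \in rho @* S.
    case/morphimP=> s _ Ss ->; rewrite -morphV ?inE // mem_morphim ?inE //.
    by rewrite -SV inE invgK.
  have [sym|[simG|[coreG simG]]] :=
    dihedral_case tiRL defG coreL maxR sSR SL dihDZ r35 q_pr oddq neqr defR oQ SV'.
  - by left; apply: symmetry_AutS sym.
  - by right; left.
  by right; right; exists K, D.
have defR : rho @* K ><| rho @* H = rho @* [set: gT] by apply: injm_sdprod; rewrite ?subsetT.
have nabR : ~~ abelian (rho @* [set: gT]) by rewrite injm_abelian.
have [sym|simG] := Frobenius_case tiRL defG coreL maxR sSR SL q_pr r_pr neqr defR
    (etrans (card_injm inj (subsetT K)) oK) (etrans (card_injm inj (subsetT H)) oH)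
    nabR.
  by left; apply: symmetry_AutS sym.
by right; left.
Qed.
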